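(* Let $\mathbf X$ be a node set in an MPDAG $\mathcal G=(\mathbf V,\mathbf E)$ and let $\mathbf V'=\mathbf V\setminus\mathbf X$. Furthermore, let $(\mathbf V_1,\dots,\mathbf V_k)$ be the output of $\mathrm{PCO}(\mathbf V,\mathcal G)$. Then for any observational density $f$ consistent with $\mathcal G$ (and whichever DAG $\mathcal D$ represented by $\mathcal G$ is used to form the interventional density $f(\cdot\mid do(\mathbf x))$) we have: 1. $f(\mathbf v)=\prod_{\mathbf V_i\subseteq\mathbf V}f(\mathbf v_i\mid\mathrm{pa}(\mathbf v_i,\mathcal G))$. 2. If there is no pair of nodes $V\in\mathbf V'$ and $X\in\mathbf X$ such that $X-V$ is in $\mathcal G$, then $$f(\mathbf v'\mid do(\mathbf x))=\prod_{\mathbf V_i\subseteq\mathbf V'}f(\mathbf v_i\mid\mathrm{pa}(\mathbf v_i,\mathcal G)),$$ for values $\mathrm{pa}(\mathbf v_i,\mathcal G)$ of $\mathrm{Pa}(\mathbf V_i,\mathcal G)$ that are in agreement with $\mathbf x$.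
   Context: Graphs. A graph $\mathcal G=(\mathbf V,\mathbf E)$ has a finite node set $\mathbf V$ and edges that are directed ($\to$) or undirected ($-$), at most one edge between any two nodes. A path is a sequence of distinct nodes with successive nodes adjacent. A causal path from $X$ to $Y$ is a path all of whose edges point towards $Y$. A directed cycle is a causal path from $X$ to $Y$ together with $Y\to X$. A PDAG is a graph with directed and undirected edges and no directed cycle; a DAG is a PDAG with only directed edges. $X$ is a parent of $Y$ if $X\to Y$; for a node set $\mathbf S$, $\mathrm{Pa}(\mathbf S,\mathcal G)$ is the set of parents of nodes in $\mathbf S$, minus $\mathbf S$. MPDAGs. An unshielded collider is $A\to B\leftarrow C$ with $A,C$ nonadjacent. A DAG $\mathcal D$ is represented by $\mathcal G$ if it has the same adjacencies and the same unshielded colliders as $\mathcal G$ and every directed edge $X\to Y$ of $\mathcal G$ is in $\mathcal D$; $[\mathcal G]$ is the set of all such DAGs. An MPDAG (maximally oriented PDAG) is a PDAG $\mathcal G$ with $[\mathcal G]\neq\emptyset$ having none of the following as an induced subgraph: (a) $K\to I$, $I-J$, with $K,J$ nonadjacent; (b) $I\to K\to J$, $I-J$; (c) $K\to J$, $L\to J$, $I-J$, $I-K$, $I-L$, with $K,L$ nonadjacent; (d) $J\to L$, $L\to K$, $I-K$, $I-J$, $I-L$, with $J,K$ nonadjacent. Buckets and PCO. A node set is undirected connected in $\mathcal G$ if every two distinct nodes of it are joined by a path in $\mathcal G$ consisting of undirected edges (the path may leave the set). For $\mathbf D\subseteq\mathbf V$, a bucket in $\mathbf D$ is a maximal undirected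 connected subset of $\mathbf D$ in $\mathcal G$; the buckets in $\mathbf D$ partition $\mathbf D$. $\mathrm{PCO}(\mathbf D,\mathcal G)$ is the ordered list produced as follows: start with the collection $\mathbf{ConComp}$ of all buckets in $\mathbf V$ and an empty list; while $\mathbf{ConComp}\ne\emptyset$, pick $\mathbf C\in\mathbf{ConComp}$ such that every edge of $\mathcal G$ between $\mathbf C$ and the nodes of the other buckets still in $\mathbf{ConComp}$ is directed into $\mathbf C$, remove $\mathbf C$ from $\mathbf{ConComp}$, and, if $\mathbf C\cap\mathbf D\neq\emptyset$, add $\mathbf C\cap\mathbf D$ to the beginning of the list; return the list. Densities. Nodes also denote random variables; densities of $\mathbf V$ are with respect to a product dominating measure. A density $f$ of $\mathbf V$ is an observational density consistent with a DAG $\mathcal D=(\mathbf V,\mathbf E)$ if $f(\mathbf v)=\prod_{V_i\in\mathbf V}f(v_i\mid \mathrm{pa}(v_i,\mathcal D))$; it is consistent with an MPDAG $\mathcal G$ if it is consistent with some DAG in $[\mathcal G]$. Given $f$ consistent with $\mathcal D$, $\mathbf X\subset\mathbf V$ and $\mathbf V'=\mathbf V\setminus\mathbf X$, the interventional density is $f(\mathbf v'\mid do(\mathbf x))=\prod_{V_i\in\mathbf V'}f(v_i\mid\mathrm{pa}(v_i,\mathcal D))$ for values $\mathrm{pa}(v_i,\mathcal D)$ of $\mathrm{Pa}(V_i,\mathcal D)$ in agreement with $\mathbf x$ (coordinates belonging to $\mathbf X$ are set to their values in $\mathbf x$), and $f(\mathbf v\mid do(\emptyset))=f(\mathbf v)$.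 Identities are understood where the conditional densities involved are well defined. *)

(* Defs.v *)
From HB Require Import structures.
From mathcomp Require Import all_boot all_order all_algebra.

Set Implicit Arguments.
Unset Strict Implicit.
Unset Printing Implicit Defensive.

(* [arrow x y] is x -> y and [line x y] is x - y; the last two fields say
   that there is at most one edge between two nodes (in particular no loop). *)
Record graph (V : finType) := Graph {
  arrow : rel V;
  line : rel V;
  line_sym : symmetric line;
  line_irr : irreflexive line;
  arrow_asym : forall x y, arrow x y -> ~~ arrow y x;
  arrow_line : forall x y, arrow x y -> ~~ line x y }.

Section Graphs.
Variable V : finType.
Implicit Types (G D : graph V) (x y : V) (S B C : {set V}).

Definition adj G x y := [|| arrow G x y, arrow G y x | line G x y].

(* Distinctness is part of nonadjacency, so that the four nodes of each
   forbidden pattern below are pairwise distinct. *)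
Definition nonadj G x y := (x != y) && ~~ adj G x y.

Definition causal_path G x (p : seq V) := path (arrow G) x p && uniq (x :: p).

Definition directed_cycle G :=
  exists x p, causal_path G x p /\ arrow G (last x p) x.

Definition is_PDAG G := ~ directed_cycle G.

Definition is_DAG G := is_PDAG G /\ forall x y, ~~ line G x y.

Definition unshielded_collider G a b c :=
  [&& arrow G a b, arrow G c b & nonadj G a c].

Definition represented D G :=
  [/\ is_DAG D,
      forall x y, adj D x y = adj G x y,
      forall a b c, unshielded_collider D a b c = unshielded_collider G a b c
    & forall x y, arrow G x y -> arrow D x y].

Definition forbidden_a G i j k :=
  [&& arrow G k i, line G i j & nonadj G k j].
Definition forbidden_b G i j k :=
  [&& arrow G i k, arrow G k j & line G i j].
Definition forbidden_c G i j k l :=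
  [&& arrow G k j, arrow G l j, line G i j, line G i k, line G i l
    & nonadj G k l].
Definition forbidden_d G i j k l :=
  [&& arrow G j l, arrow G l k, line G i k, line G i j, line G i l
    & nonadj G j k].

Definition is_MPDAG G :=
  [/\ is_PDAG G, (exists D, represented D G) &
    [/\ forall i j k, ~~ forbidden_a G i j k,
        forall i j k, ~~ forbidden_b G i j k,
        forall i j k l, ~~ forbidden_c G i j k l
      & forall i j k l, ~~ forbidden_d G i j k l]].

Definition Pa S G : {set V} := [set y | [exists x in S, arrow G y x]] :\: S.

(* [connect] is the existence of a path in the whole graph, which may leave S. *)
Definition und_connected G S :=
  [forall x in S, forall y in S, connect (line G) x y].

(* The nonemptiness condition only matters when B is empty. *)
Definition bucket G B S :=
  (S != set0) && maxset (fun S' => (S' \subset B) && und_connected G S') S.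

Definition buckets G B : {set {set V}} := [set S | bucket G B S].

Definition into G C (CC : {set {set V}}) :=
  [forall C' in CC :\ C, forall x in C, forall y in C',
     adj G x y ==> arrow G y x].

(* [PCO_loop G B CC L L']: from the state (ConComp, list) = (CC, L) the while
   loop can return L'; it is a relation because of the free choice of C. *)
Inductive PCO_loop G B : {set {set V}} -> seq {set V} -> seq {set V} -> Prop :=
| PCO_done L : PCO_loop G B set0 L L
| PCO_step (CC : {set {set V}}) (C : {set V}) L L' : C \in CC -> into G C CC ->
    PCO_loop G B (CC :\ C)
      (if C :&: B != set0 then C :&: B :: L else L) L' ->
    PCO_loop G B CC L L'.

Definition PCO_output B G (L : seq {set V}) :=
  PCO_loop G B (buckets G [set: V]) [::] L.

End Graphs.

From mathcomp Require Import all_classical all_reals all_analysis.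
From mathcomp Require Import measurable_realfun.

Import Order.TTheory GRing.Theory Num.Theory.
Local Open Scope classical_set_scope.
Local Open Scope ring_scope.
Local Open Scope ereal_scope.

Section Values.
Context (V : finType) (d : V -> measure_display).
Variable T : forall u, measurableType (d u).

Definition vals : Type := forall u, T u.

HB.instance Definition _ := Pointed.copy vals (forall u, T u).

Definition vals_measurable : set (set vals) :=
  <<s \bigcup_(u in [set: V])
        preimage_set_system setT (fun x : vals => x u) measurable >>.

Definition vals_display : measure_display.
Proof. exact: default_measure_display. Qed.

Let vals0 : vals_measurable set0. Proof. exact: sigma_algebra0. Qed.
Let valsC A : vals_measurable A -> vals_measurable (~` A).
Proof. exact: sigma_algebraC. Qed.
Let valsU (F : (set vals)^nat) : (forall i, vals_measurable (F i)) ->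
  vals_measurable (\bigcup_i F i).
Proof. exact: sigma_algebra_bigcup. Qed.

HB.instance Definition _ := @isMeasurable.Build vals_display vals
  vals_measurable vals0 valsC valsU.

Lemma measurable_coord u : measurable_fun setT (fun x : vals => x u).
Proof.
move=> _ A mA; apply: sub_gen_smallest; exists u => //; by exists A.
Qed.

Lemma measurable_fun_vals d' (U : measurableType d') (g : U -> vals) :
  (forall u, measurable_fun setT (fun x => g x u)) -> measurable_fun setT g.
Proof.
move=> mg; apply: (@measurability _ _ _ _ setT g
  (\bigcup_(u in [set: V])
     preimage_set_system setT (fun x : vals => x u) measurable)) => //.
move=> _ [_ [u _ [A mA <-]] <-]; rewrite !setTI.
by have := mg u measurableT A mA; rewrite setTI.
Qed.

End Values.

Section Product.
Context (V : finType) (d : V -> measure_display).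
Context (T : forall u, measurableType (d u)) (R : realType).
Variable mu : forall u, {sigma_finite_measure set (T u) -> \bar R}.
Implicit Types (f : vals T -> \bar R) (x : vals T).

(* Integrates the coordinates listed in s, the head of s outermost; the
   remaining coordinates are read off the argument. *)
Fixpoint int_out (s : seq V) f : vals T -> \bar R :=
  if s is u :: s' then
    fun x => \int[mu u]_y int_out s' f (dfwith x u y)
  else f.

Lemma measurable_dfwith u :
  measurable_fun setT (fun z : vals T * T u => (dfwith z.1 u z.2 : vals T)).
Proof.
apply: measurable_fun_vals => w; have [<-|uw] := eqVneq u w.
  apply: (@eq_measurable_fun _ _ _ _ _ snd) => //.
  by move=> z _; rewrite dfwithin.
apply: (@eq_measurable_fun _ _ _ _ _ (fun z : vals T * T u => z.1 w)).
  by move=> z _; rewrite dfwithout.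
by apply: (measurableT_comp (@measurable_coord _ _ T w)).
Qed.

Lemma int_out_ge0 s f : (forall x, 0 <= f x) -> forall x, 0 <= int_out s f x.
Proof.
move=> f0; elim: s => [//|u s IH] x /=.
by apply: integral_ge0 => y _; exact: IH.
Qed.

Lemma measurable_int_out s f : measurable_fun setT f -> (forall x, 0 <= f x) ->
  measurable_fun setT (int_out s f).
Proof.
move=> mf f0; elim: s => [//|u s IH] /=.
apply: (@measurable_fun_fubini_tonelli_F _ _ (vals T) (T u) R (mu u)
  (fun z => int_out s f (dfwith z.1 u z.2))).
  exact: (measurableT_comp IH (@measurable_dfwith u)).
by move=> z; exact: int_out_ge0.
Qed.

Lemma measurable_int_out_dfwith s f u x :
  measurable_fun setT f -> (forall x, 0 <= f x) ->
  measurable_fun setT (fun y => int_out s f (dfwith x u y)).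
Proof.
by move=> mf f0;
  exact: (measurableT_comp (measurable_int_out s mf f0)
  (measurableT_comp (@measurable_dfwith u) (measurable_pair1 x))).
Qed.

Lemma int_out0 s x : int_out s (fun=> 0) x = 0.
Proof. by elim: s x => [//|u s IH] x /=; apply: integral0_eq => y _. Qed.

Lemma int_out_nneseries s (f : (vals T -> \bar R)^nat) x :
  (forall n, measurable_fun setT (f n)) -> (forall n x, 0 <= f n x) ->
  int_out s (fun x => \sum_(0 <= n <oo) f n x) x =
  \sum_(0 <= n <oo) int_out s (f n) x.
Proof.
move=> mf f0; elim: s x => [//|u s IH] x /=.
rewrite -integral_nneseries //; last 2 first.
- by move=> n; exact: measurable_int_out_dfwith.
- by move=> n y _; exact: int_out_ge0.
by apply: eq_integral => y _; rewrite IH.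
Qed.

(* The base point is irrelevant, since all coordinates are integrated out;
   [prod_measure_box] below checks that this is the product of the mu u. *)
Definition prod_measure (A : set (vals T)) : \bar R :=
  int_out (enum V) (fun x => (\1_A x)%:E) point.

Let prod_measure0 : prod_measure set0 = 0.
Proof.
rewrite /prod_measure -[RHS](int_out0 (enum V) point); congr int_out.
by apply/funext => x; rewrite indic0.
Qed.

Let prod_measure_ge0 A : 0 <= prod_measure A.
Proof. by apply: int_out_ge0 => x; rewrite lee_fin. Qed.

Let prod_measure_sigma_additive : semi_sigma_additive prod_measure.
Proof.
move=> F mF tF mUF.
have -> : prod_measure (\bigcup_n F n) = \sum_(0 <= n <oo) prod_measure (F n).
  rewrite /prod_measure -int_out_nneseries.
  - by congr int_out; apply/funext => x; rewrite indic_bigcup.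
  - by move=> n; apply/measurable_EFinP; exact: measurable_indic.
  - by move=> n x; rewrite lee_fin.
by apply: is_cvg_nneseries => n _ _.
Qed.

HB.instance Definition _ := isMeasure.Build _ _ _ prod_measure
  prod_measure0 prod_measure_ge0 prod_measure_sigma_additive.

Lemma int_out_box (A : forall u, set (T u)) (s : seq V) x : uniq s ->
  (forall u, measurable (A u)) ->
  int_out s (fun x => (\1_[set x : vals T | forall u, A u (x u)] x)%:E) x =
  (\1_[set x : vals T | forall u, u \notin s -> A u (x u)] x)%:E *
  \prod_(u <- s) mu u (A u).
Proof.
move=> + mA; elim: s x => [|u s IH] x /=.
  move=> _; rewrite big_nil mule1; congr (_ %:E).
  rewrite !indicE; congr ((_ : bool)%:R)%R.
  by apply/idP/idP; rewrite !inE /= => H w //; apply: H.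
case/andP => us us'; under eq_integral do rewrite IH//.
rewrite big_cons; set P := \prod_(_ <- s) _.
have P0 : 0 <= P by rewrite /P; apply: prode_ge0 => w _.
set c := (\1_[set x : vals T | forall w, w \notin u :: s -> A w (x w)] x : R).
have c0 : (0 <= c)%R by rewrite /c indicE ler0n.
transitivity (\int[mu u]_y ((c%:E * P) * (\1_(A u) y)%:E)).
  apply: eq_integral => y _; rewrite muleAC -EFinM; congr (_%:E * _).
  rewrite /c !indicE -natrM mulnb; congr ((_ : bool)%:R)%R.
  apply/idP/andP; rewrite !inE /=.
    move=> H; split; last by have := H u us; rewrite dfwithin.
    move=> w; rewrite inE negb_or => /andP[wu ws].
    by have := H w ws; rewrite dfwithout// eq_sym.
  move=> [H1 H2] w ws; have [<-|uw] := eqVneq u w; first by rewrite dfwithin.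
  by rewrite dfwithout//; apply: H1; rewrite inE negb_or eq_sym uw.
rewrite ge0_integralZl//.
- by rewrite integral_indic// setIT muleAC -muleA.
- by apply/measurable_EFinP; exact: measurable_indic.
- by apply: mule_ge0 => //; rewrite lee_fin.
Qed.

Lemma prod_measure_box (A : forall u, set (T u)) :
  (forall u, measurable (A u)) ->
  prod_measure [set x | forall u, A u (x u)] = \prod_u mu u (A u).
Proof.
move=> mA; rewrite /prod_measure int_out_box ?enum_uniq// big_enum /=.
rewrite indicE mem_set ?mul1e// => u; by rewrite mem_enum.
Qed.

(* Density at x of the nodes in S under the joint density f: the coordinates
   outside S are integrated out, so only the coordinates of x in S matter. *)
Definition marginal (f : vals T -> R) (S : {set V}) x : \bar R :=
  int_out (enum (~: S)%SET) (EFin \o f) x.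

Definition cond_defined (f : vals T -> R) (B : {set V}) x : Prop :=
  0 < marginal f B x < +oo.

(* f(x_A | x_B); only meaningful when [cond_defined f B x]. *)
Definition cond (f : vals T -> R) (A B : {set V}) x : R :=
  (fine (marginal f (A :|: B)%SET x) / fine (marginal f B x))%R.

Definition is_density (f : vals T -> R) :=
  [/\ measurable_fun setT f, forall x, (0 <= f x)%R
    & \int[prod_measure]_x (f x)%:E = 1].

(* Densities are determined up to null sets, so identities between them are
   identities almost everywhere. *)
Definition consistent_DAG (f : vals T -> R) (D : graph V) :=
  is_density f /\
  {ae prod_measure, forall v : vals T,
    (forall u, cond_defined f (Pa [set u]%SET D) v) ->
    f v = (\prod_u cond f [set u]%SET (Pa [set u]%SET D) v)%R}.

Definition consistent (f : vals T -> R) (G : graph V) :=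
  exists2 D, represented D G & consistent_DAG f D.

(* The values v with the coordinates in X set to their values in x. *)
Definition agree (X : {set V}) (x v : vals T) : vals T :=
  fun u => if u \in X then x u else v u.

(* f(v' | do(x)), formed with D: x is only used on X, v only outside X. *)
Definition do_density (f : vals T -> R) (D : graph V) (X : {set V})
    (x v : vals T) : R :=
  (if X == finset.set0 then f v
   else \prod_(u | u \notin X) cond f [set u]%SET (Pa [set u]%SET D)
          (agree X x v))%R.

End Product.

(* Main.v *)
Require Import Defs.
From mathcomp Require Import all_boot all_order all_algebra.
From mathcomp Require Import all_classical all_reals all_analysis.
From mathcomp Require Import measurable_realfun.

(** Let [f] be consistent with the DAG [D0] represented by [G], and let [D] be any
    DAG represented by [G].

    With the convention [x / 0 = 0], the factorization of [f] along [D0] holds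
    almost everywhere without any condition: where some parent density vanishes,
    so does [f]. The relations [D0] and [D] have the same skeleton and the same
    unshielded colliders, so one is obtained from the other by reversing covered
    arrows one at a time ([markov_equiv_ind]); such a reversal does not change the
    product of the conditional densities ([factorizes_flip]). Hence [f] also
    factorizes along [D].

    In a factorization along [D] the marginal density of an ancestral set is the
    product of the conditional densities of its nodes ([marginal_ancestral]). The
    delicate point is that a conditional density integrates to 1 only where the
    density of its parents is positive; a comparison of total masses shows that
    nothing is lost elsewhere.

    The output of PCO orders the buckets so that all edges between buckets go
    forward. Therefore the buckets before a given bucket [S] form an ancestral
    set [A] of [D], which contains [Pa S G] and stays ancestral when [S] is added
    ([PCO_output_block]). Dividing the marginal density of [A :|: S] by that of
    [A], and integrating out the nodes of [A] that are not in [Pa S G], shows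
    that the conditional density of [S] given [Pa S G] is the product over the
    nodes of [S] of their conditional densities given their parents in [D]
    ([cond_block]).

    The first claim is the product of these identities over all buckets. For the
    second one, no bucket meets both [X] and its complement, so the product over
    the buckets outside [X] is the truncated factorization along [D]; the null
    set on which the identities may fail has null sections for almost all values
    of the nodes in [X] ([ae_agree]). *)

Set Implicit Arguments.
Unset Strict Implicit.
Unset Printing Implicit Defensive.

(** * Acyclic relations and reversal of covered arrows *)

Section Digraphs.
(* finite sets take precedence over classical sets here *)
Import boot.fintype boot.finset.
Variable V : finType.
Implicit Types (e : rel V) (x y a b : V).

(** Acyclicity, expressed by a numbering of the nodes that increases along the
    arrows. The numbering need not be injective. *)
Definition ranked e := exists r : V -> nat, forall x y, e x y -> r x < r y.

(** Adjacency: the skeleton of [e]. *)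
Definition skel e x y := e x y || e y x.

(** Unshielded colliders [a -> b <- c]. *)
Definition ucoll e a b c := [&& e a b, e c b & (a != c) && ~~ skel e a c].

(** Same skeleton and same unshielded colliders; for acyclic relations this is
    Markov equivalence. *)
Definition markov_equiv e e' :=
  (forall x y, skel e x y = skel e' x y) /\
  (forall a b c, ucoll e a b c = ucoll e' a b c).

(** The set of parents of a node. *)
Definition pa e u : {set V} := [set x | e x u]%SET.

(** The arrow [a -> b] is covered when [a] is the only parent of [b] that is not
    a parent of [a]. *)
Definition covered e a b := e a b && (pa e b == a |: pa e a)%SET.

(** The relation [e] with the arrow [a -> b] reversed. *)
Definition flip e a b : rel V :=
  fun x y => ((x == b) && (y == a)) || (e x y && ~~ ((x == a) && (y == b))).

Lemma skelC e x y : skel e x y = skel e y x.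
Proof. by rewrite /skel orbC. Qed.

Lemma ranked_irr e x : ranked e -> e x x = false.
Proof. by move=> [r er]; apply/negP => /er; rewrite ltnn. Qed.

Lemma ranked_asym e x y : ranked e -> e x y -> e y x = false.
Proof.
by move=> [r er] /er xy; apply/negP => /er yx; have := ltn_trans xy yx;
  rewrite ltnn.
Qed.

Lemma ranked_connect e (r : V -> nat) :
  (forall x y, e x y -> r x < r y) -> forall x y, connect e x y -> r x <= r y.
Proof.
move=> er x y /connectP[p + ->]; elim: p x => //= z p IH x /andP[/er xz /IH].
by apply: leq_trans; exact: ltnW.
Qed.

Lemma coveredP e a b x : covered e a b -> e x b = (x == a) || e x a.
Proof. by move=> /andP[_ /eqP/setP/(_ x)]; rewrite !inE. Qed.

(** If some arrow of [e] is reversed in the Markov equivalent relation [e'], then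
    some covered arrow is. Take [b] minimal among the heads of reversed arrows,
    then [a] maximal among the tails of the reversed arrows into [b]: an
    additional parent of [a] or [b] would create a cycle or an unshielded
    collider in only one of the two relations. *)
Lemma exists_covered e e' : ranked e -> ranked e' -> markov_equiv e e' ->
  (exists a b, e a b && e' b a) -> exists a b, covered e a b && e' b a.
Proof.
move=> re re' [eqs equ] [a0 [b0 ab0]].
have [r er] := re.
pose Q b := [exists a, e a b && e' b a].
have Qb0 : Q b0 by apply/existsP; exists a0.
have [b /existsP[a1 a1b] bmin] := @arg_minnP _ b0 Q r Qb0.
have [a /andP[eab e'ba] amax] :=
  @arg_maxnP _ a1 (fun a => e a b && e' b a) r a1b.
(* no arrow whose head comes before b is reversed *)
have keep x y : r y < r b -> e x y -> e' x y.
  move=> yb exy; have := eqs x y; rewrite /skel exy /= => /esym/orP[//|e'yx].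
  have /bmin : Q y by apply/existsP; exists x; rewrite exy.
  by rewrite /= leqNgt yb.
exists a, b; rewrite e'ba andbT /covered eab /=; apply/eqP/setP => z.
rewrite !inE; apply/idP/idP.
- move=> ezb; have [//|za] := eqVneq z a; rewrite orFb.
  have : skel e z a.
    apply: contraT => nza; have : ucoll e z b a by rewrite /ucoll ezb eab za.
    rewrite equ /ucoll => /and3P[_ e'ab _].
    by rewrite (ranked_asym re' e'ab) in e'ba.
  move=> /orP[//|eaz].
  have e'az := keep _ _ (er _ _ ezb) eaz.
  have := eqs z b; rewrite /skel ezb /= => /esym/orP[e'zb|e'bz].
    have [r' er'] := re'.
    have := ltn_trans (er' _ _ e'zb) (ltn_trans (er' _ _ e'ba) (er' _ _ e'az)).
    by rewrite ltnn.
  have /amax : e z b && e' b z by rewrite ezb.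
  by rewrite /= leqNgt (er _ _ eaz).
- move=> /orP[/eqP->//|eza].
  have e'za := keep _ _ (er _ _ eab) eza.
  have zb : z != b by apply/eqP => zb; rewrite zb (ranked_asym re eab) in eza.
  have : skel e z b.
    apply: contraT => nzb; have : ucoll e' z a b.
      by rewrite /ucoll e'za e'ba zb -eqs.
    rewrite -equ /ucoll => /and3P[_ eba _].
    by rewrite (ranked_asym re eba) in eab.
  move=> /orP[//|ebz].
  have := ltn_trans (er _ _ eab) (ltn_trans (er _ _ ebz) (er _ _ eza)).
  by rewrite ltnn.
Qed.

Lemma flip_skel e a b : e a b -> forall x y, skel (flip e a b) x y = skel e x y.
Proof.
move=> eab x y; rewrite /skel /flip.
have [/andP[/eqP-> /eqP->]|nab] := boolP ((x == a) && (y == b)).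
  by rewrite eab !eqxx !orbT.
have [/andP[/eqP-> /eqP->]|nba] := boolP ((y == a) && (x == b)).
  by rewrite eab !eqxx !orbT.
by rewrite [(x == b) && _]andbC [(y == b) && _]andbC (negbTE nab) (negbTE nba)
  !andbT.
Qed.

Lemma flip_ranked e a b : ranked e -> covered e a b -> ranked (flip e a b).
Proof.
move=> re cab; have [r er] := re; have /andP[eab _] := cab.
pose e1 : rel V := fun x y => e x y && ~~ ((x == a) && (y == b)).
have e1e x y : e1 x y -> e x y by move=> /andP[].
(* after removing a -> b, node b cannot be reached from a: its remaining
   parents are parents of a *)
have nab : ~~ connect e1 a b.
  apply/negP => /connectP[p]; case/lastP: p => [_ ba|p z].
    by rewrite ba (ranked_irr _ re) in eab.
  rewrite rcons_path last_rcons => /andP[pp +] bz; rewrite -{z}bz /e1 => /andP[].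
  rewrite (coveredP _ cab) eqxx andbT => /orP[->//|eza] _.
  have : connect e1 a (last a p) by apply/connectP; exists p.
  move=> /(ranked_connect (fun x y h => er x y (e1e x y h))).
  by rewrite leqNgt (er _ _ eza).
exists (fun v => r v + (if connect e1 a v then \sum_u (r u).+1 else 0)).
move=> x y /orP[/andP[/eqP-> /eqP->]|xy].
  rewrite (negbTE nab) connect0 addn0 (bigD1 b) //= addSn addnS ltnS addnCA.
  exact: leq_addr.
have xy' := er _ _ (e1e _ _ xy).
case: ifP => [ax|_]; last by rewrite addn0 ltn_addr.
have e1xy : e1 x y by exact: xy.
by rewrite (connect_trans ax (connect1 e1xy)) ltn_add2r.
Qed.

Lemma flip_equiv e a b : ranked e -> covered e a b -> markov_equiv (flip e a b) e.
Proof.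
move=> re cab; have /andP[eab _] := cab; have fs := flip_skel eab.
split=> // x y z; rewrite /ucoll fs; set n := (x != z) && _.
case: (boolP n) => [/andP[xz nxz]|_]; last by rewrite !andbF.
rewrite !andbT /flip.
have aNb : (a == b) = false by apply/eqP => ab; rewrite ab (ranked_irr _ re) in eab.
have [->|ya] := eqVneq y a; rewrite ?aNb ?andbF ?andbT ?orbF.
  (* colliders at a involving b are shielded *)
  have sh w : skel e b w || ~~ e w a.
    case: (boolP (e w a)) => [wa|_]; last by rewrite orbT.
    by rewrite /skel (coveredP w cab) wa !orbT.
  have [xb|_] := eqVneq x b; have [zb|_] := eqVneq z b; rewrite //=.
  - by rewrite xb zb eqxx in xz.
  - have := sh z; rewrite -xb (negbTE nxz) /= => /negbTE->.
    by rewrite xb (ranked_asym re eab).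
  - have := sh x; rewrite skelC -zb (negbTE nxz) /= => /negbTE->.
    by rewrite ?andbF.
have [->|yb] := eqVneq y b; rewrite ?aNb ?andbF ?andbT ?orbF //=.
have sh w : skel e a w || ~~ e w b || (w == a).
  case: (boolP (e w b)) => [|_]; last by rewrite orbT.
  rewrite (coveredP w cab).
  by move=> /orP[->|wa]; rewrite /skel ?wa ?orbT.
have [xa|_] := eqVneq x a; have [za|_] := eqVneq z a; rewrite ?andbT //=.
- by rewrite xa za eqxx in xz.
- have := sh z; rewrite -xa (negbTE nxz) /= [z == x]eq_sym (negbTE xz) orbF.
  by move=> /negbTE->; rewrite !andbF.
- have := sh x; rewrite skelC -za (negbTE nxz) /= (negbTE xz) orbF.
  by move=> /negbTE->; rewrite ?andbF.
Qed.

Lemma pa_flip_tail e a b : ranked e -> e a b ->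
  pa (flip e a b) a = (b |: pa e a)%SET.
Proof.
move=> re eab; apply/setP => x; rewrite !inE /flip eqxx andbT.
have [ab|_] := eqVneq a b; first by rewrite ab (ranked_irr _ re) in eab.
by rewrite andbF andbT.
Qed.

Lemma pa_flip_head e a b : ranked e -> covered e a b ->
  pa (flip e a b) b = pa e a.
Proof.
move=> re cab; apply/setP => x; rewrite !inE /flip eqxx andbT.
rewrite (coveredP x cab); have /andP[eab _] := cab.
have [ba|_] := eqVneq b a; first by rewrite ba (ranked_irr _ re) in eab.
rewrite andbF /=; have [->|_] := eqVneq x a; last by rewrite andbT.
by rewrite (ranked_irr _ re).
Qed.

Lemma pa_flip_other e a b u : u != a -> u != b -> pa (flip e a b) u = pa e u.
Proof.
move=> ua ub; apply/setP => x; rewrite !inE /flip (negbTE ua) (negbTE ub).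
by rewrite !andbF andbT.
Qed.

(** Markov equivalent acyclic relations are connected by a sequence of reversals
    of covered arrows (Chickering), stated as an induction principle. Each
    reversal lowers the number of arrows of [e] reversed in [e']. *)
Lemma markov_equiv_ind (P : rel V -> Prop) :
  (forall e a b, ranked e -> covered e a b -> P e -> P (flip e a b)) ->
  forall e e', ranked e -> ranked e' -> markov_equiv e e' -> P e -> P e'.
Proof.
move=> Pflip e e' + re'.
have [n] := ubnP #|[set p | e p.1 p.2 && e' p.2 p.1]%SET|.
elim: n e => // n IH e; rewrite ltnS => en re eqe Pe.
have [eqs equ] := eqe.
have [[a [b ab]]|nab] := pselect (exists a b, e a b && e' b a); last first.
  suff -> : e' = e by [].
  apply/funext => x; apply/funext => y; apply/idP/idP => exy.
    have := eqs x y; rewrite /skel exy /= => /orP[//|eyx].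
    by exfalso; apply: nab; exists y, x; rewrite eyx.
  have := eqs x y; rewrite /skel exy /= => /esym/orP[//|eyx].
  by exfalso; apply: nab; exists x, y; rewrite exy.
have [|a1 [b1 /andP[cab e'ba]]] := exists_covered re re' eqe.
  by exists a, b.
have /andP[eab _] := cab.
have [fs fu] := flip_equiv re cab.
apply: (IH (flip e a1 b1)); last 3 first.
- exact: flip_ranked.
- by split=> *; rewrite ?fs ?fu ?eqs ?equ.
- exact: Pflip.
apply: leq_trans en; apply: proper_card; apply/properP; split.
  apply/subsetP => -[x y]; rewrite !inE /flip /= => /andP[/orP[|/andP[-> _]->//]].
  move=> /andP[/eqP-> /eqP->] e'ab.
  by rewrite (ranked_asym re' e'ba) in e'ab.
exists (a1, b1); rewrite !inE /= ?eab ?e'ba // /flip !eqxx !andbF orbF andbT.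
by apply/negP => /andP[/eqP ab1 _]; rewrite ab1 (ranked_irr _ re) in eab.
Qed.

End Digraphs.

(** * Represented DAGs, buckets and their partial causal ordering *)

Section Buckets.
(* finite sets take precedence over classical sets here *)
Import boot.fintype boot.finset.
Variable V : finType.
Implicit Types (G D : graph V) (x y u : V) (S C : {set V}) (L : seq {set V}).

Lemma adjC G x y : adj G x y = adj G y x.
Proof. by rewrite /adj orbCA line_sym. Qed.

Lemma DAG_ranked D : is_DAG D -> ranked (arrow D).
Proof.
move=> [acyc _]; exists (fun y => #|[set z | connect (arrow D) z y]|) => x y xy.
apply: proper_card; apply/properP; split.
  by apply/subsetP => z; rewrite !inE => zx; apply: connect_trans zx (connect1 xy).
exists y; rewrite inE ?connect0 //.
apply/negP => /connectP[p yp xE]; apply: acyc.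
rewrite xE in xy; case/shortenP: yp xy => p' yp' up' _ xy.
by exists y, p'; split=> //; rewrite /causal_path yp'.
Qed.

Lemma represented_ranked D G : represented D G -> ranked (arrow D).
Proof. by move=> [dagD _ _ _]; exact: DAG_ranked. Qed.

Lemma DAG_skel D x y : is_DAG D -> skel (arrow D) x y = adj D x y.
Proof. by move=> [_ nl]; rewrite /skel /adj (negbTE (nl x y)) orbF. Qed.

Lemma represented_markov D D' G : represented D G -> represented D' G ->
  markov_equiv (arrow D) (arrow D').
Proof.
move=> [dagD aD uD _] [dagD' aD' uD' _]; split=> [x y|a b c].
  by rewrite !DAG_skel // aD aD'.
have ucollE E : is_DAG E -> ucoll (arrow E) a b c = unshielded_collider E a b c.
  by move=> dagE; rewrite /ucoll DAG_skel.
by rewrite !ucollE // uD uD'.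
Qed.

Lemma Pa1 D u : Pa [set u] D = pa (arrow D) u.
Proof.
apply/setP => y; rewrite !inE; apply/andP/idP => [[_ /existsP[x]]|yu].
  by rewrite inE => /andP[/eqP->].
split.
  apply: contraTneq yu => ->; apply/negP => uu.
  by have := arrow_asym uu; rewrite uu.
by apply/existsP; exists u; rewrite inE eqxx.
Qed.

Lemma line_connect_sym G : connect_sym (line G).
Proof. exact/sym_connect_sym/line_sym. Qed.

(** The buckets in the whole node set are the connected components of the
    undirected edges. *)
Lemma mem_buckets G S :
  S \in buckets G [set: V] =
  [exists x, S == [set y | connect (line G) x y]].
Proof.
have und x : und_connected G [set y | connect (line G) x y].
  apply/forall_inP => y; rewrite inE => xy; apply/forall_inP => z; rewrite inE.
  by apply: connect_trans; rewrite line_connect_sym.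
rewrite inE /bucket; apply/andP/existsP => [[/set0Pn[x xS] /maxsetP[]]|].
  move=> /andP[_ /forall_inP/(_ x xS)/forall_inP cS] max; exists x.
  rewrite eq_sym; apply/eqP/max; first by rewrite subsetT und.
  by apply/subsetP => y yS; rewrite inE cS.
move=> [x /eqP->]; split; first by apply/set0Pn; exists x; rewrite inE.
apply/maxsetP; split; first by rewrite subsetT und.
move=> C /andP[_ /forall_inP cC] sC; apply/eqP; rewrite eqEsubset sC andbT.
have xC : x \in C by apply: (subsetP sC); rewrite inE.
by apply/subsetP => y yC; rewrite inE (forall_inP (cC x xC)).
Qed.

Lemma buckets_connect G S x y : S \in buckets G [set: V] -> x \in S ->
  (y \in S) = connect (line G) x y.
Proof.
rewrite mem_buckets => /existsP[z /eqP->]; rewrite !inE => zx.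
by rewrite (same_connect (line_connect_sym G) zx).
Qed.

Lemma buckets_partition G : partition (buckets G [set: V]) [set: V].
Proof.
apply/and3P; split.
- rewrite -subTset; apply/subsetP => x _; apply/bigcupP.
  exists [set y | connect (line G) x y]; last by rewrite inE.
  by rewrite mem_buckets; apply/existsP; exists x.
- apply/trivIsetP => S S' bS bS' nS; rewrite -setI_eq0; apply: contraNT nS.
  move=> /set0Pn[x]; rewrite inE => /andP[xS xS']; apply/eqP/setP => y.
  by rewrite (buckets_connect _ bS xS) (buckets_connect _ bS' xS').
- by rewrite inE /bucket eqxx.
Qed.

(** Every edge between [S] and [S'] is directed into [S']. *)
Definition before G S S' :=
  [forall x in S, forall y in S', adj G x y ==> arrow G x y].

Lemma beforeP G S S' x y :
  before G S S' -> x \in S -> y \in S' -> adj G x y -> arrow G x y.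
Proof.
by move=> /forall_inP/(_ x)/[apply]/forall_inP/(_ y)/[apply]/implyP.
Qed.

(** Invariant of the loop: the list is ordered by [before], and all edges from
    the remaining components go into it. *)
Lemma PCO_loop_before G CC L L' : PCO_loop G [set: V] CC L L' ->
  set0 \notin CC -> pairwise (before G) L ->
  (forall C S, C \in CC -> S \in L -> before G C S) ->
  pairwise (before G) L' /\ perm_eq L' (L ++ enum CC).
Proof.
elim=> {CC L L'} [L _ pL _|CC C L L' CCC iC _ IH nCC pL bL].
  by rewrite enum_set0 cats0.
have C0 : C != set0 by apply: contraNneq nCC => <-.
move: IH; rewrite setIT C0 => /(_ _ _ _)[||C' S|pL' permL'].
- by rewrite !inE negb_and nCC orbT.
- by rewrite pairwise_cons pL andbT; apply/allP => S; exact: bL.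
- rewrite !inE => /andP[C'C C'CC] /orP[/eqP->|SL]; last exact: bL.
  apply/forall_inP => x xC'; apply/forall_inP => y yC; apply/implyP.
  rewrite adjC; apply/implyP.
  have C'D : C' \in CC :\ C by rewrite !inE C'C.
  by have /forall_inP/(_ _ C'D)/forall_inP/(_ _ yC)/forall_inP/(_ _ xC') := iC.
- split=> //; rewrite (perm_trans permL') // -cat1s -catA perm_catCA perm_cat2l.
  rewrite perm_sym uniq_perm ?enum_uniq //= ?mem_enum ?inE ?eqxx ?enum_uniq //.
  move=> S; rewrite !inE !mem_enum !inE.
  by have [->|] := eqVneq S C; rewrite ?CCC.
Qed.

Lemma PCO_output_before G L : PCO_output [set: V] G L ->
  pairwise (before G) L /\ perm_eq L (enum (buckets G [set: V])).
Proof.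
move=> /PCO_loop_before /=; apply=> //.
by have /and3P[] := buckets_partition G.
Qed.

(** Sets of nodes that contain the parents of their elements. *)
Definition ancestral (e : rel V) (A : {set V}) :=
  forall x u, e x u -> u \in A -> x \in A.

(** The nodes that occur in a list of node sets. *)
Definition nodes L : {set V} := [set x | has (fun S : {set V} => x \in S) L].

(** A directed edge of [D] between two buckets cannot be undirected in [G], hence
    it has the orientation given by the order of the list. *)
Lemma ancestral_prefix D G L L1 L2 : represented D G ->
  PCO_output [set: V] G L -> L = L1 ++ L2 -> ancestral (arrow D) (nodes L1).
Proof.
move=> [_ aD _ oD] /PCO_output_before[+ permL] LE x u xu.
rewrite LE pairwise_cat => /and3P[/allrelP bL _ _].
rewrite !inE => /hasP[S SL1 uS].
have : x \in cover (buckets G [set: V]).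
  by rewrite (cover_partition (buckets_partition G)) inE.
move=> /bigcupP[S']; rewrite -mem_enum -(perm_mem permL) LE mem_cat => S'L xS'.
have [S'1|S'1] := boolP (S' \in L1); first by apply/hasP; exists S'.
rewrite (negbTE S'1) in S'L.
have /oD ux : arrow G u x.
  by apply: (beforeP (bL _ _ SL1 S'L)) => //; rewrite -aD /adj xu orbT.
by have := arrow_asym xu; rewrite ux.
Qed.

Lemma parent_bucket D G S x u : represented D G ->
  S \in buckets G [set: V] -> u \in S -> arrow D x u -> x \in S :|: Pa S G.
Proof.
move=> [_ aD _ oD] bS uS xu; rewrite !inE; case: (boolP (x \in S)) => //= xS.
apply/existsP; exists u; rewrite uS /=.
have : adj G x u by rewrite -aD /adj xu.
rewrite /adj => /or3P[//|/oD ux|xu'].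
  by have := arrow_asym xu; rewrite ux.
by rewrite (buckets_connect _ bS uS) connect1 // line_sym in xS.
Qed.


(** What the order of the buckets is used for: the nodes of the buckets before
    [S] form an ancestral set of [D] that remains so when [S] is added, and that
    contains the parents of [S]. *)
Lemma PCO_output_block D G L S : represented D G ->
  PCO_output [set: V] G L -> S \in L ->
  exists A, [/\ ancestral (arrow D) A, ancestral (arrow D) (A :|: S),
    [disjoint A & S], Pa S G \subset A &
    forall u, u \in S -> pa (arrow D) u \subset S :|: Pa S G].
Proof.
move=> DG pcoL SL; have [_ _ _ oD] := DG.
have [_ permL] := PCO_output_before pcoL.
have bL S' : S' \in L -> S' \in buckets G [set: V].
  by rewrite (perm_mem permL) mem_enum.
have uL : uniq L by rewrite (perm_uniq permL) enum_uniq.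
have [L1 [L2 LE]] : exists L1 L2, L = L1 ++ S :: L2.
  by case/splitPr: SL => L1 L2; exists L1, L2.
have nodesS : nodes L1 :|: S = nodes (rcons L1 S).
  by apply/setP => x; rewrite !inE has_rcons orbC.
have dAS : [disjoint nodes L1 & S].
  rewrite -setI_eq0; apply: contraTT uL => /set0Pn[x].
  rewrite !inE => /andP[/hasP[S' S'1 xS'] xS].
  have S'L : S' \in L by rewrite LE mem_cat S'1.
  suff SS' : S = S' by rewrite LE cat_uniq SS' /= S'1 andbF.
  apply/setP => y; rewrite (buckets_connect _ (bL _ SL) xS).
  by rewrite (buckets_connect _ (bL _ S'L) xS').
have ancA : ancestral (arrow D) (nodes L1) by exact: ancestral_prefix DG pcoL LE.
have ancAS : ancestral (arrow D) (nodes L1 :|: S).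
  by rewrite nodesS; apply: (ancestral_prefix DG pcoL (L2 := L2)); rewrite cat_rcons.
exists (nodes L1); split=> //.
- apply/subsetP => x; rewrite !inE => /andP[xS /existsP[u /andP[uS /oD xu]]].
  have /(ancAS _ _ xu) : u \in nodes L1 :|: S by rewrite inE uS orbT.
  by rewrite !inE (negbTE xS) orbF.
- move=> u uS; apply/subsetP => x; rewrite inE => xu.
  exact: (parent_bucket DG (bL _ SL) uS xu).
Qed.

Lemma big_PCO (R : Type) (idx : R) (op : Monoid.com_law idx) G L (F : V -> R) :
  PCO_output [set: V] G L ->
  \big[op/idx]_u F u = \big[op/idx]_(S <- L) \big[op/idx]_(u in S) F u.
Proof.
move=> /PCO_output_before[_ permL]; rewrite (perm_big _ permL) big_enum /=.
rewrite -(set_partition_big _ (buckets_partition G)) /=.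
by apply: eq_bigl => u; rewrite inE.
Qed.

(** Without undirected edges between [X] and its complement, every bucket lies
    on one side. *)
Lemma big_PCO_compl (R : Type) (idx : R) (op : Monoid.com_law idx) G (X : {set V}) L
    (F : V -> R) : PCO_output [set: V] G L ->
  (forall v x, v \notin X -> x \in X -> ~~ line G x v) ->
  \big[op/idx]_(u | u \notin X) F u =
  \big[op/idx]_(S <- L | S \subset ~: X) \big[op/idx]_(u in S) F u.
Proof.
move=> pcoL nXl; rewrite big_mkcond (big_PCO _ _ pcoL) [RHS]big_mkcond.
rewrite !(big_seq_cond predT) /=; apply: eq_bigr => S; rewrite andbT.
have /PCO_output_before[_ permL] := pcoL.
rewrite (perm_mem permL) mem_enum => bS; case: ifPn => [SX|].
  apply: eq_bigr => u uS; have := subsetP SX u uS.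
  by rewrite inE => ->.
move=> /subsetPn[x xS]; rewrite inE negbK => xX; apply: big1 => u uS.
suff -> : u \in X by [].
have clX : fingraph.closed (line G) X.
  have imp y z : line G y z -> y \in X -> z \in X.
    move=> yz yX; apply: contraTT yz => zX; exact: nXl.
  by move=> y z yz; apply/idP/idP; apply: imp; rewrite // line_sym.
by rewrite -(closed_connect clX (_ : connect _ x u)) // -(buckets_connect u bS xS).
Qed.

End Buckets.

(** * Integrating out coordinates *)

Section IntOut.
Import Order.TTheory GRing.Theory Num.Theory.
Local Open Scope classical_set_scope.
Local Open Scope ring_scope.
Local Open Scope ereal_scope.
Import HBNNSimple.
Context (V : finType) (d : V -> measure_display).
Context (T : forall u, measurableType (d u)) (R : realType).
Variable mu : forall u, {sigma_finite_measure set (T u) -> \bar R}.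
Implicit Types (g h c : vals T -> \bar R) (x v : vals T) (s : seq V) (u w : V).
Implicit Types (A B : {set V}).

(** Measurable functions with nonnegative extended-real values. *)
Definition mge0 g := measurable_fun setT g /\ forall x, 0 <= g x.

Lemma mge0_int_out s g : mge0 g -> mge0 (int_out mu s g).
Proof.
by move=> [mg g0]; split; [exact: measurable_int_out|exact: int_out_ge0].
Qed.

Lemma mge0_dfwith u x g : mge0 g -> measurable_fun setT (fun y => g (dfwith x u y)).
Proof. by move=> [mg g0]; exact: (measurable_int_out_dfwith mu [::] x mg g0). Qed.

Lemma mge0D g h : mge0 g -> mge0 h -> mge0 (fun x => g x + h x).
Proof.
move=> [mg g0] [mh h0]; split; first exact: emeasurable_funD.
by move=> x; exact: adde_ge0.
Qed.

Lemma mge0M g h : mge0 g -> mge0 h -> mge0 (fun x => g x * h x).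
Proof.
move=> [mg g0] [mh h0]; split; first exact: emeasurable_funM.
by move=> x; exact: mule_ge0.
Qed.

Lemma mge0_cst (k : \bar R) : 0 <= k -> mge0 (fun=> k).
Proof. by move=> k0; split. Qed.

Lemma mge0_indic (N : set (vals T)) : measurable N -> mge0 (fun x => (\1_N x)%:E).
Proof.
move=> mN; split; first by apply/measurable_EFinP; exact: measurable_indic.
by move=> x; rewrite lee_fin indicE ler0n.
Qed.

Lemma dfwithC u w x (y : T u) (z : T w) : u != w ->
  dfwith (dfwith x u y) w z = dfwith (dfwith x w z) u y.
Proof.
move=> uw; apply: functional_extensionality_dep => k.
have [<-|wk] := eqVneq w k; first by rewrite dfwithin dfwithout ?dfwithin.
rewrite [LHS]dfwithout//.
have [<-|uk] := eqVneq u k; first by rewrite !dfwithin.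
by rewrite !dfwithout.
Qed.

Lemma int_out_cat s1 s2 g :
  int_out mu (s1 ++ s2) g = int_out mu s1 (int_out mu s2 g).
Proof. by elim: s1 => //= u s ->. Qed.

Lemma int_out_swap u w g : mge0 g ->
  int_out mu [:: u; w] g = int_out mu [:: w; u] g.
Proof.
move=> [mg g0]; have [->//|uw] := eqVneq u w; apply/funext => x /=.
rewrite (fubini_tonelli (fun z => g (dfwith (dfwith x u z.1) w z.2)))/=.
- by apply: eq_integral => y _; apply: eq_integral => z _; rewrite dfwithC.
- apply: (measurableT_comp mg).
  apply: (measurableT_comp (@measurable_dfwith _ _ T w)
    (g := fun z : T u * T w => (dfwith x u z.1 : vals T, z.2))).
  apply/measurable_fun_pair => //=.
  exact: (measurableT_comp (measurableT_comp (@measurable_dfwith _ _ T u)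
    (measurable_pair1 x))).
- by move=> z; exact: g0.
Qed.

Lemma int_out_consC u s g : mge0 g ->
  int_out mu (u :: s) g = int_out mu s (int_out mu [:: u] g).
Proof.
move=> mg; elim: s => // w s IH.
rewrite -[in LHS]/([:: u; w] ++ s) int_out_cat int_out_swap;
  last exact: mge0_int_out.
by rewrite -int_out_cat -[_ ++ s]/([:: w] ++ (u :: s)) int_out_cat IH -int_out_cat.
Qed.

Lemma int_out_catC s1 s2 g : mge0 g ->
  int_out mu (s1 ++ s2) g = int_out mu (s2 ++ s1) g.
Proof.
elim: s1 g => [|u s IH] g mg; first by rewrite cats0.
rewrite cat_cons int_out_consC// IH; last exact: mge0_int_out.
by rewrite !int_out_cat -int_out_consC.
Qed.

Lemma int_out_perm s1 s2 g : mge0 g -> perm_eq s1 s2 ->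
  int_out mu s1 g = int_out mu s2 g.
Proof.
move=> mg p12; move: (erefl (int_out mu s1 g)).
apply: (catCA_perm_ind (P := fun s => int_out mu s1 g = int_out mu s g) _ p12).
move=> t1 t2 t3 ->; rewrite !catA [LHS]int_out_cat int_out_catC;
  last exact: mge0_int_out.
by rewrite -int_out_cat.
Qed.

(** [g] only depends on the coordinates in [A]. *)
Definition depends_only A g :=
  forall x v, (forall u, u \in A -> x u = v u) -> g x = g v.

Lemma depends_only_int_out A B s g : depends_only A g ->
  (forall u, u \in A -> u \notin s -> u \in B) ->
  depends_only B (int_out mu s g).
Proof.
move=> gA; elim: s B => [|u s IH] B AB x v xv /=.
  by apply: gA => u uA; apply/xv/AB.
apply: eq_integral => y _; apply: (IH (u |: B)%SET) => [w wA ws|w].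
  by rewrite !inE; have [//|wu] := eqVneq w u; rewrite AB// inE negb_or wu.
rewrite !inE; have [->|wu] := eqVneq w u; first by rewrite !dfwithin.
by move=> /= wB; rewrite !dfwithout 1?eq_sym// xv.
Qed.

(** Factors that do not depend on the integrated coordinates can be pulled out. *)
Lemma int_outZ B s c g : depends_only B c -> (forall u, u \in B -> u \notin s) ->
  (forall x, 0 <= c x) -> mge0 g ->
  forall x, int_out mu s (fun x => c x * g x) x = c x * int_out mu s g x.
Proof.
move=> cB Bs c0 mg; elim: s Bs => //= u s IH Bs x.
have [mg' g'0] := mge0_int_out s mg.
rewrite -ge0_integralZl//; last exact/mge0_dfwith/mge0_int_out.
apply: eq_integral => y _; rewrite IH; last first.
  by move=> w wB; have := Bs w wB; rewrite inE negb_or => /andP[].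
congr (_ * _); apply: cB => w wB; rewrite dfwithout//.
by have := Bs w wB; rewrite inE negb_or eq_sym => /andP[].
Qed.

Lemma int_outZc s (k : \bar R) g : 0 <= k -> mge0 g ->
  forall x, int_out mu s (fun x => k * g x) x = k * int_out mu s g x.
Proof.
move=> k0 mg x; apply: (@int_outZ finset.set0) => //.
by move=> u; rewrite inE.
Qed.

Lemma int_outD s g h : mge0 g -> mge0 h ->
  forall x, int_out mu s (fun x => g x + h x) x =
            int_out mu s g x + int_out mu s h x.
Proof.
move=> mg mh; elim: s => //= u s IH x; under eq_integral do rewrite IH.
have [mg' g'0] := mge0_int_out s mg; have [mh' h'0] := mge0_int_out s mh.
by rewrite ge0_integralD//; exact/mge0_dfwith/mge0_int_out.
Qed.

Lemma le_int_out s g h : mge0 g -> mge0 h -> (forall x, g x <= h x) ->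
  forall x, int_out mu s g x <= int_out mu s h x.
Proof.
move=> mg mh gh; elim: s => //= u s IH x.
have [mg' g'0] := mge0_int_out s mg; have [mh' h'0] := mge0_int_out s mh.
by apply: ge0_le_integral => //; exact/mge0_dfwith/mge0_int_out.
Qed.

Lemma mge0_sum (I : Type) (r : seq I) (g_ : I -> vals T -> \bar R) :
  (forall i, mge0 (g_ i)) -> mge0 (fun x => \sum_(i <- r) g_ i x).
Proof.
move=> mg; split; first by apply: emeasurable_sum => i; case: (mg i).
by move=> x; apply: sume_ge0 => i _; case: (mg i).
Qed.

Lemma int_out_sum s (I : Type) (r : seq I) (g_ : I -> vals T -> \bar R) :
  (forall i, mge0 (g_ i)) ->
  forall x, int_out mu s (fun x => \sum_(i <- r) g_ i x) x =
            \sum_(i <- r) int_out mu s (g_ i) x.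
Proof.
move=> mg x; elim: r => [|i r IH].
  rewrite big_nil; under [X in int_out _ _ X]eq_fun do rewrite big_nil.
  exact: int_out0.
rewrite big_cons -IH -int_outD//; last exact: mge0_sum.
by under eq_fun do rewrite big_cons.
Qed.

(** Monotone convergence for iterated integrals. *)
Lemma int_out_cvg s (g_ : nat -> vals T -> \bar R) g :
  (forall n, mge0 (g_ n)) -> (forall x, nondecreasing_seq (g_ ^~ x)) ->
  (forall x, g_ n x @[n --> \oo] --> g x) ->
  forall x, int_out mu s (g_ n) x @[n --> \oo] --> int_out mu s g x.
Proof.
move=> mg nd gc; elim: s => //= u s IH x.
have mgs n := mge0_int_out s (mg n).
rewrite (_ : \int[mu u]_y _ = \int[mu u]_y
    (limn (fun n => int_out mu s (g_ n) (dfwith x u y)))); last first.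
  by apply: eq_integral => y _; apply/esym/cvg_lim => //; exact: IH.
apply: (cvg_monotone_convergence (mu := mu u) measurableT
    (g' := fun n y => int_out mu s (g_ n) (dfwith x u y))).
- by move=> n; exact/mge0_dfwith.
- by move=> n y _; case: (mgs n).
- by move=> y _ m n mn; apply: le_int_out => // v; exact: nd.
Qed.

(** Integrating against the product measure amounts to integrating out all the
    coordinates. *)
Lemma ge0_integral_prod g : mge0 g ->
  \int[prod_measure mu]_x g x = int_out mu (enum V) g point.
Proof.
move=> [mg g0]; pose g_ := nnsfun_approx measurableT mg.
have nd x : nondecreasing_seq (fun n => (g_ n x)%:E).
  by move=> m n mn; rewrite lee_fin; exact/lefP/nd_nnsfun_approx.
have gc x : (g_ n x)%:E @[n --> \oo] --> g x.
  exact: (@cvg_nnsfun_approx _ _ _ setT measurableT g mg (fun x _ => g0 x)).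
have mg_ n : mge0 (fun x => (g_ n x)%:E).
  by split=> [|x]; [exact/measurable_EFinP|rewrite lee_fin].
have -> : \int[prod_measure mu]_x g x =
    limn (fun n => \int[prod_measure mu]_x (g_ n x)%:E).
  rewrite -(monotone_convergence _ measurableT (fun n => (mg_ n).1)
    (fun n x _ => (mg_ n).2 x) (fun x _ => nd x)).
  by apply: eq_integral => x _; apply/esym/cvg_lim => //; exact: gc.
have /cvg_lim <- // := @int_out_cvg (enum V) _ _ mg_ nd gc point.
congr (limn _); apply/funext => n; set h := g_ n.
pose r (i : nat) := (finmap.enum_fset (fset_set (range h)))`_i.
pose t i x := (r i)%:E * (\1_(h @^-1` [set r i]) x)%:E.
have hE : (fun x => (h x)%:E) =
    (fun x => \sum_(i < size (finmap.enum_fset (fset_set (range h)))) t i x).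
  apply/funext => x; rewrite fimfunEord -sumEFin.
  by apply: eq_bigr => i _; rewrite /t EFinM.
have mN (i : nat) : measurable (h @^-1` [set r i]) by exact: measurable_sfunP.
have mt (i : nat) : mge0 (t i).
  have [[x rx]|nr] := pselect (exists x, h x = r i).
    by apply: mge0M; [apply: mge0_cst; rewrite lee_fin -rx|exact: mge0_indic].
  rewrite (_ : t i = cst 0); first exact: mge0_cst.
  apply/funext => x; rewrite /t indicE memNset ?mule0// => /= hx.
  by apply: nr; exists x.
(* both sides are linear, so the claim reduces to indicator functions *)
rewrite hE int_out_sum// ge0_integral_sum//; last 2 first.
- by move=> i; case: (mt i).
- by move=> i x _; case: (mt i).
apply: eq_bigr => i _; rewrite /t.
have [[x rx]|nr] := pselect (exists x, h x = r i).
  rewrite ge0_integralZl//; last by rewrite lee_fin -rx.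
    rewrite integral_indic// setIT int_outZc//; first by rewrite lee_fin -rx.
    exact: mge0_indic.
  by case: (mge0_indic (mN i)).
rewrite (_ : (fun x => _) = cst 0); last first.
  apply/funext => x; rewrite indicE memNset ?mule0// => /= hx.
  by apply: nr; exists x.
by rewrite integral0 int_out0.
Qed.

End IntOut.

(** * Null sets and partial integration *)

Section AlmostEverywhere.
Import Order.TTheory GRing.Theory Num.Theory.
Local Open Scope classical_set_scope.
Local Open Scope ring_scope.
Local Open Scope ereal_scope.
Context (V : finType) (d : V -> measure_display).
Context (T : forall u, measurableType (d u)) (R : realType).
Variable mu : forall u, {sigma_finite_measure set (T u) -> \bar R}.
Implicit Types (g h c : vals T -> \bar R) (x v : vals T) (s : seq V) (u w : V).
Implicit Types (A B C : {set V}).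

Lemma ae_eq0P g : mge0 g ->
  {ae prod_measure mu, forall x, g x = 0} <->
  int_out mu (enum V) g point = 0.
Proof.
move=> mg; have [mg1 g0] := mg; rewrite -ge0_integral_prod//.
have := ae_eq_integral_abs (prod_measure mu) measurableT mg1.
rewrite (_ : \int[prod_measure mu]_x `|g x| = \int[prod_measure mu]_x g x).
  by move=> ->; split; apply: filterS => x // /(_ Logic.I).
by apply: eq_integral => x _; rewrite gee0_abs.
Qed.

(** The function [g] with the coordinates in [A] integrated out. *)
Definition int_set A g := int_out mu (enum A) g.

Lemma mge0_int_set A g : mge0 g -> mge0 (int_set A g).
Proof. exact: mge0_int_out. Qed.

Lemma int_set_perm A s g : mge0 g -> uniq s -> s =i A ->
  int_set A g = int_out mu s g.
Proof.
move=> mg us sA; apply: int_out_perm => //.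
by apply: uniq_perm => [||x]; rewrite ?enum_uniq// mem_enum sA.
Qed.

Lemma int_set_U A B C g : mge0 g -> [disjoint A & B]%B -> C = (A :|: B)%SET ->
  int_set C g = int_set A (int_set B g).
Proof.
move=> mg dAB ->; rewrite /int_set -int_out_cat; apply: int_set_perm => //.
  rewrite cat_uniq !enum_uniq andbT /=; apply/hasPn => x; rewrite !mem_enum => xB.
  by apply: contraTN xB => xA; rewrite (disjointFr dAB xA).
by move=> x; rewrite mem_cat !mem_enum inE.
Qed.

Lemma int_set_setT g : mge0 g -> int_set [set: V]%SET g = int_out mu (enum V) g.
Proof.
move=> mg; apply: (int_set_perm mg (enum_uniq _)) => x.
by rewrite mem_enum finset.in_setT.
Qed.

Lemma int_set_set0 g : int_set finset.set0 g = g.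
Proof. by rewrite /int_set enum_set0. Qed.

Lemma int_set_set1 u g : int_set [set u]%SET g = int_out mu [:: u] g.
Proof. by rewrite /int_set enum_set1. Qed.

Lemma depends_only_int_set A B C g : depends_only A g -> (A :\: B \subset C)%SET ->
  depends_only C (int_set B g).
Proof.
move=> gA /fintype.subsetP ABC; apply: (depends_only_int_out mu gA) => u uA.
by rewrite mem_enum => uB; apply: ABC; rewrite inE uB.
Qed.

Lemma depends_only_setT g : depends_only [set: V]%SET g.
Proof.
move=> x v xv; congr g; apply: functional_extensionality_dep => u.
by apply: xv; rewrite inE.
Qed.

Lemma int_set_Z A B c g : mge0 g -> depends_only B c -> [disjoint A & B]%B ->
  (forall x, 0 <= c x) ->
  forall x, int_set A (fun x => c x * g x) x = c x * int_set A g x.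
Proof.
move=> mg cB dAB c0; apply: (int_outZ mu cB) => // u uB.
by rewrite mem_enum (disjointFl dAB uB).
Qed.

(** A nonnegative function vanishes almost everywhere as soon as its partial
    integral over some coordinates vanishes there. *)
Lemma ae_int_set_eq0 A g : mge0 g ->
  {ae prod_measure mu, forall x, int_set A g x = 0 -> g x = 0}.
Proof.
move=> mg; have [mI I0] := mge0_int_set A mg; have [_ g0] := mg.
(* replace [g] by its product with the indicator of [N], all of whose partial
   integrals vanish *)
pose N := [set x | int_set A g x = 0].
have mN : measurable N.
  by rewrite -[N]setTI; exact: (mI measurableT [set 0] (emeasurable_set1 0)).
have mc := mge0_indic R mN.
have dI := depends_only_int_set (@depends_only_setT g)
  (fintype.subxx ([set: V] :\: A)%SET).
have dc : depends_only ([set: V] :\: A)%SET (fun x => (\1_N x)%:E : \bar R).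
  move=> x v xv; rewrite !indicE; congr ((_ : bool)%:R%:E).
  by apply/idP/idP; rewrite !inE /N /= (dI _ _ xv).
have : int_out mu (enum V) (fun x => (\1_N x)%:E * g x) point = 0.
  rewrite -int_set_setT; last exact: mge0M.
  rewrite (@int_set_U (~: A)%SET A); [|exact: mge0M| |]; last 2 first.
  - by rewrite -finset.setI_eq0 finset.setIC finset.setICr.
  - by rewrite finset.setUC finset.setUCr.
  rewrite (_ : int_set A _ = fun=> 0) ?int_out0//; first exact: int_out0.
  apply/funext => x; rewrite (int_set_Z mg dc); last 2 first.
  - by rewrite -finset.setI_eq0 finset.setTD finset.setICr.
  - by case: mc.
  rewrite indicE; case: (boolP (x \in N)); last by rewrite mul0e.
  by rewrite inE /N /= => ->; rewrite mule0.
move=> /ae_eq0P => /(_ (mge0M mc mg)); apply: filterS => x + xN.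
by rewrite indicE mem_set// mul1e.
Qed.

(** Partial integration preserves being null: a null set has null sections at
    almost every point. *)
Lemma ae_int_out_eq0 s g : mge0 g ->
  {ae prod_measure mu, forall x, g x = 0} ->
  {ae prod_measure mu, forall x, int_out mu s g x = 0}.
Proof.
elim: s g => [//|u s IH] g mg ae0.
rewrite int_out_consC//; apply: IH; first exact: mge0_int_out.
have mI := mge0_int_out mu [:: u] mg.
apply/ae_eq0P => //; move/(ae_eq0P mg) : ae0.
have pV : perm_eq (enum V) (rem u (enum V) ++ [:: u]).
  by rewrite perm_sym perm_catC perm_sym perm_to_rem// mem_enum.
rewrite !(int_out_perm mu _ pV)// !int_out_cat => g0.
have -> : int_out mu [:: u] (int_out mu [:: u] g) =
    (fun x => mu u setT * int_out mu [:: u] g x).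
  apply/funext => x; rewrite muleC.
  transitivity (\int[mu u]_y (cst (int_out mu [:: u] g x) y)).
    2: by rewrite integral_cst.
  apply: eq_integral => y _ /=; apply: eq_integral => z _; congr g.
  apply: functional_extensionality_dep => w.
  by have [<-|uw] := eqVneq u w; rewrite ?dfwithin// !dfwithout.
by rewrite int_outZc ?g0 ?mule0//; exact: mge0_int_out.
Qed.

(** A property holding almost everywhere can only fail on a measurable null set. *)
Lemma ae_null (P : vals T -> Prop) : {ae prod_measure mu, forall x, P x} ->
  exists N, [/\ measurable N, forall x, ~ P x -> N x
    & {ae prod_measure mu, forall x, (\1_N x)%:E = 0 :> \bar R}].
Proof.
move=> [N [mN N0 PN]]; exists N; split=> [//|x nPx|]; first exact: PN.
exists N; split=> // x /= xN; apply: contrapT => nN; apply: xN.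
by rewrite indicE memNset.
Qed.

Lemma ae_le_int_out s g h : mge0 g -> mge0 h ->
  {ae prod_measure mu, forall x, g x <= h x} ->
  {ae prod_measure mu, forall x, int_out mu s g x <= int_out mu s h x}.
Proof.
move=> mg mh /ae_null[N [mN gh N0]]; have mc := mge0_indic R mN.
have := ae_int_out_eq0 s mc N0; apply: filterS => x cN0.
have my : mge0 ((fun=> +oo) : vals T -> \bar R) := mge0_cst _ (leey 0).
have myc := mge0M my mc.
have : int_out mu s g x <= int_out mu s (fun x => h x + +oo * (\1_N x)%:E) x.
  apply: le_int_out => // [|v]; first exact: mge0D.
  (* on the null set [N] the bound is infinite *)
  have [vN|vN] := pselect (N v); last first.
    rewrite indicE memNset// mule0 adde0; apply: contrapT => /gh; exact: vN.
  by rewrite indicE mem_set// mule1 addey ?leey// gt_eqF// (lt_le_trans _ (mh.2 v)).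
by rewrite int_outD// int_outZc// cN0 mule0 adde0.
Qed.

Lemma ae_eq_int_out s g h : mge0 g -> mge0 h ->
  {ae prod_measure mu, forall x, g x = h x} ->
  {ae prod_measure mu, forall x, int_out mu s g x = int_out mu s h x}.
Proof.
move=> mg mh gh.
have gh1 : {ae prod_measure mu, forall x, g x <= h x}.
  by apply: filterS gh => x ->.
have gh2 : {ae prod_measure mu, forall x, h x <= g x}.
  by apply: filterS gh => x ->.
have := ae_le_int_out s mh mg gh2; have := ae_le_int_out s mg mh gh1.
by apply: filterS2 => x le1 le2; apply/eqP; rewrite eq_le le1.
Qed.

(** A function with finite partial integrals is finite almost everywhere. *)
Lemma ae_int_set_fin A g : mge0 g -> (forall x, int_set A g x < +oo) ->
  {ae prod_measure mu, forall x, g x < +oo}.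
Proof.
move=> mg Ag; have [mg1 g0] := mg.
pose N := [set x | g x = +oo].
have mN : measurable N.
  by rewrite -[N]setTI; exact: (mg1 measurableT [set +oo] (emeasurable_set1 +oo)).
have mc := mge0_indic R mN.
have I0 x : int_set A (fun x => (\1_N x)%:E) x = 0.
  apply/eqP; rewrite eq_le (mge0_int_set A mc).2 andbT leNgt; apply/negP => I0.
  have := Ag x; rewrite ltNge => /negP; apply.
  rewrite -(gt0_mulye I0) /int_set -int_outZc//.
  apply: le_int_out => // [|v]; first exact: (mge0M (mge0_cst _ (leey 0)) mc).
  have [vN|vN] := pselect (N v); last by rewrite indicE memNset// mule0.
  by rewrite vN leey.
have := ae_int_set_eq0 A mc; apply: filterS => x /(_ (I0 x)).
rewrite indicE; case: (boolP (x \in N)) => [_ [] /eqP|]; first by rewrite oner_eq0.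
by rewrite ltey => /negP xN _; apply/eqP => gx; apply: xN; rewrite inE.
Qed.

(** A property that holds almost everywhere still does after almost every
    substitution of values for the coordinates in [A]. *)
Lemma ae_agree A (P : vals T -> Prop) : {ae prod_measure mu, forall x, P x} ->
  {ae prod_measure mu, forall x, {ae prod_measure mu, forall v, P (agree A x v)}}.
Proof.
move=> /ae_null[N [mN PN N0]]; have mc := mge0_indic R mN.
have := ae_int_out_eq0 (enum (~: A)%SET) mc N0; apply: filterS => x cN0.
have magree : measurable_fun setT (agree A x : vals T -> vals T).
  apply: measurable_fun_vals => u; rewrite /agree; case: (u \in A) => //.
  exact: measurable_coord.
have mca : mge0 (fun v => (\1_N (agree A x v))%:E : \bar R).
  by split=> [|v]; [exact: (measurableT_comp mc.1 magree)|exact: mc.2].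
have agreeI s g v : (forall u, u \in s -> u \notin A) ->
    int_out mu s (fun v => g (agree A x v)) v = int_out mu s g (agree A x v).
  elim: s v => //= u s IH v sA; apply: eq_integral => y _; rewrite IH; last first.
    by move=> w ws; apply: sA; rewrite inE ws orbT.
  congr int_out; apply: functional_extensionality_dep => w; rewrite /agree.
  have [<-|uw] := eqVneq u w; last by rewrite !dfwithout.
  by rewrite !dfwithin (negbTE (sA u (mem_head _ _))).
have := ae_int_set_eq0 (~: A)%SET mca; apply: filterS => v vN.
apply: contrapT => /PN Nv; have : (\1_N (agree A x v))%:E = 0 :> \bar R.
  apply: vN; rewrite /int_set (agreeI (enum (~: A)%SET) (fun v => (\1_N v)%:E)).
    2: by move=> u; rewrite mem_enum inE.
  rewrite -cN0.
  apply: (depends_only_int_out mu (@depends_only_setT (fun x => (\1_N x)%:E))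
    (B := A)) => u; last by rewrite /agree => ->.
  by rewrite mem_enum !inE negbK.
by rewrite indicE mem_set// => -[] /eqP; rewrite oner_eq0.
Qed.

End AlmostEverywhere.

(** * Marginal and conditional densities *)

Section Marginals.
Import Order.TTheory GRing.Theory Num.Theory.
Local Open Scope classical_set_scope.
Local Open Scope ring_scope.
Local Open Scope ereal_scope.
Context (V : finType) (d : V -> measure_display).
Context (T : forall u, measurableType (d u)) (R : realType).
Variable mu : forall u, {sigma_finite_measure set (T u) -> \bar R}.
Variable f : vals T -> R.
Hypothesis fd : is_density mu f.
Implicit Types (x v : vals T) (u w : V) (A B C S P : {set V}) (e : rel V).
Local Notation M := (marginal mu f).

Lemma mge0_density : mge0 (EFin \o f).
Proof.
by have [mf f0 _] := fd; split=> [|x]; [exact/measurable_EFinP|rewrite lee_fin].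
Qed.

Lemma mge0_marginal A : mge0 (M A).
Proof. exact/mge0_int_out/mge0_density. Qed.

Lemma marginal_ge0 A x : 0 <= M A x. Proof. exact: (mge0_marginal A).2. Qed.

Lemma marginal_setT x : M [set: V]%SET x = (f x)%:E.
Proof. by rewrite /marginal finset.setCT enum_set0. Qed.

Lemma depends_only_marginal A : depends_only A (M A).
Proof.
apply: (depends_only_int_set mu (B := (~: A)%SET) (@depends_only_setT _ _ _ _ _)).
by rewrite finset.setTD finset.setCK.
Qed.

(** Marginalizing in two steps. *)
Lemma marginal_int_set A B : (A \subset B)%SET ->
  M A = int_set mu (B :\: A)%SET (M B).
Proof.
move=> AB; rewrite /marginal -!/(int_set _ _ _).
apply: int_set_U; first exact: mge0_density.
- rewrite -finset.setI_eq0; apply/eqP/finset.setP => u; rewrite !inE.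
  by case: (u \in B); rewrite ?andbF.
- apply/finset.setP => u; rewrite !inE.
  by have := fintype.subsetP AB u; case: (u \in A) => [->|]//=; case: (u \in B).
Qed.

Lemma marginal_set0 x : M finset.set0 x = 1.
Proof.
rewrite (depends_only_marginal (v := point)); last by move=> u; rewrite inE.
rewrite /marginal finset.setC0 -/(int_set mu _ _) (int_set_setT mu mge0_density).
by rewrite -ge0_integral_prod; [case: fd|exact: mge0_density].
Qed.

Lemma int_set_marginal A x : int_set mu A (M A) x = 1.
Proof.
rewrite -[in int_set _ A](finset.setD0 A).
by rewrite -marginal_int_set ?marginal_set0 ?finset.sub0set.
Qed.

(** The points at which all marginal densities are finite and the marginal density
    of a set of nodes vanishes whenever that of a subset does; almost all points
    are such. *)
Definition regular v :=
  (forall A, M A v < +oo) /\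
  (forall A B, (A \subset B)%SET -> M A v = 0 -> M B v = 0).

Lemma ae_regular : {ae prod_measure mu, forall v, regular v}.
Proof.
suff [H1 H2] : {ae prod_measure mu, forall v, forall A, M A v < +oo} /\
    {ae prod_measure mu, forall v, forall A B, (A \subset B)%SET ->
      M A v = 0 -> M B v = 0}.
  by apply: filterS2 H1 H2 => v ? ?; split.
split.
  apply: filter_forall => A.
  apply: (@ae_int_set_fin _ _ _ _ mu A _ (mge0_marginal A)) => x.
  by rewrite int_set_marginal ltry.
apply: filter_forall => A; apply: filter_forall => B.
have := ae_int_set_eq0 mu (B :\: A)%SET (mge0_marginal B).
apply: filterS => v + AB.
by rewrite -marginal_int_set.
Qed.

Lemma regular_fineK v A : regular v -> (fine (M A v))%:E = M A v.
Proof. by move=> [fin _]; rewrite fineK// ge0_fin_numE ?marginal_ge0. Qed.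

Lemma regular_fine0 v A B : regular v -> (A \subset B)%SET ->
  fine (M A v) = 0%R -> fine (M B v) = 0%R.
Proof.
move=> rv AB MA0; have [_ /(_ A B AB)] := rv.
by rewrite -(regular_fineK A rv) -(regular_fineK B rv) MA0 => /(_ erefl)[].
Qed.

Lemma mge0_cond A B : mge0 (fun v => (cond mu f A B v)%:E).
Proof.
have fm C : measurable_fun setT (fun v => fine (M C v)).
  exact: (measurableT_comp (fine_measurable measurableT) (mge0_marginal C).1).
have f0 C v : (0 <= fine (M C v))%R by rewrite fine_ge0// marginal_ge0.
split=> [|v]; last by rewrite lee_fin divr_ge0.
apply/measurable_EFinP.
(* the inverse is measurable as a real power *)
rewrite (_ : cond mu f A B =
  (fun v => fine (M (A :|: B)%SET v) * (fine (M B v)) `^ (-1))%R).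
  by apply: measurable_funM => //; exact: (measurableT_comp (measurable_powR _)).
by apply/funext => v; rewrite powR_inv1.
Qed.

Lemma depends_only_cond A B C : (A :|: B \subset C)%SET ->
  depends_only C (fun v => (cond mu f A B v)%:E).
Proof.
move=> /fintype.subsetP ABC x v xv; rewrite /cond.
rewrite (depends_only_marginal (v := v)); last by move=> u /ABC; exact: xv.
rewrite (@depends_only_marginal B x v)// => u uB.
by apply/xv/ABC; rewrite inE uB orbT.
Qed.

(** A conditional density of one node integrates to one over the values of this
    node, except where the conditioning density is zero or infinite, in which
    case the default value of the division makes it vanish identically. *)
Lemma int_set_cond u P x : u \notin P ->
  int_set mu [set u]%SET (fun v => (cond mu f [set u]%SET P v)%:E) x =
  if 0 < M P x < +oo then 1 else 0.
Proof.
move=> uP; rewrite int_set_set1 /=.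
have MPE y : M P (dfwith x u y) = M P x.
  apply: depends_only_marginal => w wP; rewrite dfwithout//.
  by apply: contraNneq uP => ->.
case: ifPn => [/andP[M0 My]|MN]; last first.
  apply: integral0_eq => y _; rewrite /cond MPE.
  have -> : fine (M P x) = 0%R; last by rewrite invr0 mulr0.
  move: MN; rewrite lt0e marginal_ge0 andbT negb_and negbK -leNgt leye_eq.
  by move=> /orP[]/eqP->.
have Mu : (P \subset [set u] :|: P)%SET by apply: finset.subsetUr.
have uPD : ([set u] :|: P) :\: P = [set u]%SET :> {set V}.
  rewrite finset.setDUl finset.setDv finset.setU0; apply/finset.setDidPl.
  by rewrite finset.disjoints1.
pose h y := M ([set u] :|: P)%SET (dfwith x u y).
have mh : measurable_fun setT h by exact/mge0_dfwith/mge0_marginal.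
have h0 y : 0 <= h y by exact: marginal_ge0.
have hE : \int[mu u]_y h y = M P x.
  by rewrite (marginal_int_set Mu) uPD int_set_set1.
have hint : (mu u).-integrable setT h.
  apply/integrableP; split=> //; rewrite (eq_integral h) ?hE// => y _.
  by rewrite gee0_abs.
have hfin := integrable_ae measurableT hint.
transitivity (\int[mu u]_y ((fine (M P x))^-1%:E * h y)).
  apply: ge0_ae_eq_integral => //.
  - apply: (measurableT_comp (mge0_cond [set u]%SET P).1).
    exact: (measurableT_comp (@measurable_dfwith _ _ T u) (measurable_pair1 x)).
  - exact: measurable_funeM.
  - by move=> y _; exact: (mge0_cond [set u]%SET P).2.
  - by move=> y _; rewrite mule_ge0// lee_fin invr_ge0 fine_ge0// ltW.
  - apply: filterS hfin => y /(_ Logic.I) hy _; rewrite /cond MPE -/(h y).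
    by rewrite -[in RHS](fineK hy) -EFinM mulrC.
rewrite ge0_integralZl//; last by rewrite lee_fin invr_ge0 fine_ge0// ltW.
have Mfin : M P x \is a fin_num by rewrite ge0_fin_numE ?marginal_ge0.
rewrite hE -[in X in _ * X](fineK Mfin) -EFinM mulVf//.
by rewrite gt_eqF// fine_gt0// M0.
Qed.

(** * Densities that factorize along an acyclic relation *)

(** The conditional density of a node given its parents; it is zero
    where the density of the parents is zero or infinite, because [x / 0 = 0] and
    [fine +oo = 0]. *)
Definition kern e u v : R := cond mu f [set u]%SET (pa e u) v.

(** The product of the kernels of the nodes in [A]. *)
Definition kern_prod e A v : R := (\prod_(u in A) kern e u v)%R.

(** The density is almost everywhere the product of all kernels, without
    assuming that the conditional densities are well defined. *)
Definition factorizes e :=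
  {ae prod_measure mu, forall v, f v = (\prod_u kern e u v)%R}.

(** Where the conditional density of some node given its parents is not well
    defined, both the density and the product of the kernels vanish, up to a null
    set. *)
Lemma consistent_factorizes D : consistent_DAG mu f D -> factorizes (arrow D).
Proof.
move=> [_ fD]; have := ae_regular; apply: filterS2 fD => v fD rv.
under eq_bigr do rewrite /kern -Pa1.
have [|/existsNP[u nu]] :=
  pselect (forall u, cond_defined mu f (Pa [set u]%SET D) v).
  exact: fD.
have Pa0 : fine (M (Pa [set u]%SET D) v) = 0%R.
  move/negP: nu; rewrite lt0e marginal_ge0 andbT negb_and negbK.
  by rewrite (rv.1 _) orbF => /eqP->.
have := regular_fine0 rv (finset.subsetT _) Pa0; rewrite marginal_setT /= => ->.
by rewrite (bigD1 u)//= /cond Pa0 invr0 mulr0 mul0r.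
Qed.

(** Reversing a covered arrow [a -> b] only changes the two kernels of [a] and
    [b]: with [P] the parents of [a], it replaces [f(a | P) f(b | a, P)] by
    [f(a | b, P) f(b | P)], which is the same function [f(a, b | P)]. *)
Lemma factorizes_flip e a b : ranked e -> covered e a b ->
  factorizes e -> factorizes (flip e a b).
Proof.
move=> re cab fe; have := ae_regular; apply: filterS2 fe => v -> rv.
have /andP[eab _] := cab.
have ab : a != b by apply: contraTneq eab => ->; rewrite (ranked_irr _ re).
have aP : a \notin pa e a by rewrite inE (ranked_irr _ re).
have bP : b \notin pa e a by rewrite inE (ranked_asym re eab).
have pab : pa e b = a |: pa e a by have /andP[_ /eqP] := cab.
rewrite (bigD1 a)//= (bigD1 b) 1?eq_sym//=.
rewrite [RHS](bigD1 a)//= [in RHS](bigD1 b) 1?eq_sym//=.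
rewrite [in RHS](eq_bigr (fun u => kern e u v)); last first.
  by move=> u /andP[ua ub]; rewrite /kern pa_flip_other.
rewrite !mulrA; congr (_ * _)%R; rewrite /kern pa_flip_tail// pa_flip_head// pab /cond.
set W := fine (M (pa e a) v).
set X := fine (M (a |: pa e a) v); set Y := fine (M (b |: pa e a) v).
rewrite finset.setUCA; set Z := fine (M _ v).
have X0 : X = 0%R -> Z = 0%R.
  by apply: regular_fine0 => //; rewrite finset.setUCA finset.subsetUr.
have Y0 : Y = 0%R -> Z = 0%R by apply: regular_fine0 => //; exact: finset.subsetUr.
have [/X0->|X0'] := eqVneq X 0%R; first by rewrite !(mulr0, mul0r).
have [/Y0->|Y0'] := eqVneq Y 0%R; first by rewrite !(mulr0, mul0r).
by rewrite mulrAC [(X / W / X)%R]mulrAC divff// mul1r divfK// mulrC.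
Qed.

Lemma factorizes_represented D D' G : represented D G -> represented D' G ->
  factorizes (arrow D) -> factorizes (arrow D').
Proof.
move=> DG D'G; apply: (markov_equiv_ind (P := factorizes)).
- exact: factorizes_flip.
- exact: represented_ranked DG.
- exact: represented_ranked D'G.
- exact: represented_markov DG D'G.
Qed.


Lemma kern_ge0 e u v : (0 <= kern e u v)%R.
Proof. by rewrite -lee_fin; exact: (mge0_cond _ _).2. Qed.

Lemma kern_prod_ge0 e A v : (0 <= kern_prod e A v)%R.
Proof. by apply: prodr_ge0 => u _; exact: kern_ge0. Qed.

Lemma mge0_kern_prod e A : mge0 (fun v => (kern_prod e A v)%:E).
Proof.
split=> [|v]; last by rewrite lee_fin kern_prod_ge0.
apply/measurable_EFinP; rewrite /kern_prod.
rewrite (_ : (fun v => _) = (fun v => \prod_(u <- enum A) kern e u v)%R).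
  by apply: measurable_prod => u _; apply/measurable_EFinP; exact: (mge0_cond _ _).1.
by apply/funext => v; rewrite big_enum.
Qed.

Lemma depends_only_kern_prod e A B :
  (forall u, u \in A -> ([set u] :|: pa e u \subset B)%SET) ->
  depends_only B (fun v => (kern_prod e A v)%:E).
Proof.
move=> AB x v xv; congr (_%:E); apply: eq_bigr => u /AB uB.
by have [] := @depends_only_cond [set u]%SET (pa e u) B uB x v xv.
Qed.

Lemma ancestral_pa e A u : ancestral e A -> u \in A ->
  ([set u] :|: pa e u \subset A)%SET.
Proof.
move=> ancA uA; rewrite finset.subUset finset.sub1set uA /=.
by apply/fintype.subsetP => x; rewrite inE => /ancA; apply.
Qed.

Lemma depends_only_ancestral e A : ancestral e A ->
  depends_only A (fun v => (kern_prod e A v)%:E).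
Proof. by move=> ancA; apply: depends_only_kern_prod => u; exact: ancestral_pa. Qed.

Lemma kern_prodU1 e A w v : w \notin A ->
  (kern_prod e (w |: A) v)%:E = (kern_prod e A v)%:E * (kern e w v)%:E.
Proof. by move=> wA; rewrite /kern_prod finset.big_setU1//= mulrC EFinM. Qed.

Lemma int_set_kern_prodU1 e A w x : ranked e -> ancestral e A -> w \notin A ->
  int_set mu [set w]%SET (fun v => (kern_prod e (w |: A) v)%:E) x =
  (kern_prod e A x)%:E * (if 0 < M (pa e w) x < +oo then 1 else 0).
Proof.
move=> re ancA wA; have wP : w \notin pa e w by rewrite inE (ranked_irr _ re).
rewrite -(int_set_cond _ wP) -(int_set_Z mu (mge0_cond _ _) (depends_only_ancestral ancA)).
- by congr int_out; apply/funext => v; rewrite kern_prodU1.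
- by rewrite finset.disjoints1.
- by move=> v; exact: (mge0_kern_prod _ _).2.
Qed.

(** The kernels of an ancestral set form a sub-density, since they can be
    integrated out in reverse topological order. *)
Lemma int_set_kern_prod_le1 e A x : ranked e -> ancestral e A ->
  int_set mu A (fun v => (kern_prod e A v)%:E) x <= 1.
Proof.
move=> re; have [r er] := re.
have [n] := ubnP #|A|; elim: n A x => // n IH A x; rewrite ltnS => An ancA.
have [->|/finset.set0Pn[w0 w0A]] := eqVneq A finset.set0.
  by rewrite int_set_set0 /kern_prod finset.big_set0.
(* no arrow goes from [w] into [A] *)
have [w wA wmax] := @arg_maxnP _ w0 (fun u => u \in A) r w0A.
pose A' := A :\ w; have AE : A = w |: A' by rewrite finset.setD1K.
have wA' : w \notin A' by rewrite !inE eqxx.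
have ancA' : ancestral e A'.
  move=> y u yu; rewrite !inE => /andP[uw uA]; rewrite (ancA _ _ yu uA) andbT.
  apply: contraTneq yu => ->; apply/negP => /er; rewrite ltnNge => /negP; apply.
  exact: wmax.
have A'n : (#|A'| < n)%N.
  by apply: leq_trans An; rewrite [in X in (_ < X)%N]AE cardsU1 wA'.
apply: le_trans (IH A' x A'n ancA').
have mg := mge0_kern_prod.
have dis : [disjoint A' & [set w]%SET]%B by rewrite disjoint_sym finset.disjoints1.
rewrite (int_set_U mu (mg e A) dis); last by rewrite finset.setUC.
rewrite [in X in int_set _ _ (int_set _ _ X)]AE.
apply: le_int_out => // [|v]; first exact: mge0_int_set.
rewrite int_set_kern_prodU1//; case: ifP => _; rewrite ?mule1// mule0.
exact: (mg e A').2.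
Qed.

(** The marginal density of an ancestral set is the product of its kernels.
    Integrating out the nodes outside [A] only shows that the marginal density
    is that product times an indicator; comparing total masses, the product has
    no mass where the indicator vanishes. *)
Lemma marginal_ancestral e A : ranked e -> factorizes e -> ancestral e A ->
  {ae prod_measure mu, forall v, M A v = (kern_prod e A v)%:E}.
Proof.
move=> re fe; have [r er] := re.
have [n] := ubnP #|~: A|; elim: n A => // n IH A; rewrite ltnS => An ancA.
have [->|AT] := eqVneq A [set: V]%SET.
  apply: filterS fe => v fv; rewrite marginal_setT fv; congr (_%:E).
  by apply: eq_bigl => u; rewrite inE.
have /finset.set0Pn[w0 w0A] : (~: A)%SET != finset.set0.
  by apply: contraNneq AT => A0; rewrite -[A]finset.setCK A0 finset.setC0.
rewrite inE in w0A.
(* [w] has all its parents in [A] *)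
have [w wA wmin] := @arg_minnP _ w0 (fun u => u \notin A) r w0A.
have ancwA : ancestral e (w |: A).
  move=> x u xu; rewrite !inE => /orP[/eqP uw|/(ancA _ _ xu)->];
    last by rewrite orbT.
  apply/orP; right; apply: contraT => /wmin; rewrite leqNgt => /negP; case.
  by rewrite -uw; exact: er.
have An1 : (#|~: (w |: A)| < n)%N.
  apply: leq_trans An; apply: proper_card; apply/properP; split.
    by rewrite finset.setCS finset.subsetUr.
  by exists w; rewrite !inE ?eqxx.
have Aw : (w |: A) :\: A = [set w]%SET :> {set V}.
  rewrite finset.setDUl finset.setDv finset.setU0; apply/finset.setDidPl.
  by rewrite finset.disjoints1.
pose c x : \bar R := if 0 < M (pa e w) x < +oo then 1 else 0.
have wP : w \notin pa e w by rewrite inE (ranked_irr _ re).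
have mc : mge0 c.
  rewrite (_ : c = int_set mu [set w]%SET (fun v => (kern e w v)%:E)).
    exact/mge0_int_set/mge0_cond.
  by apply/funext => x; rewrite int_set_cond.
have mg := mge0_kern_prod e A.
have Mgc : {ae prod_measure mu, forall v, M A v = (kern_prod e A v)%:E * c v}.
  have := ae_eq_int_out (enum [set w]%SET) (mge0_marginal _)
    (mge0_kern_prod e _) (IH _ An1 ancwA).
  apply: filterS => v; rewrite -!/(int_set mu _ _ _) int_set_kern_prodU1// => <-.
  by rewrite (marginal_int_set (finset.subsetUr [set w]%SET A)) Aw.
(* the complementary indicator of [c] *)
pose N := [set x | c x = 0].
have mN : measurable N.
  by rewrite -[N]setTI; exact: (mc.1 measurableT [set 0] (emeasurable_set1 0)).
pose c' x : \bar R := (\1_N x)%:E.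
have mc' : mge0 c' by exact: mge0_indic.
have cc' x : (c x = 1 /\ c' x = 0) \/ (c x = 0 /\ c' x = 1).
  rewrite /c' indicE; have [xN|xN] := pselect (N x).
    by right; rewrite mem_set.
  left; rewrite memNset//; split=> //; move: xN; rewrite /N /= /c.
  by case: ifP.
have mgc := mge0M mg mc; have mgc' := mge0M mg mc'.
have gE : (fun x => (kern_prod e A x)%:E) =
    (fun x => (kern_prod e A x)%:E * c x + (kern_prod e A x)%:E * c' x).
  by apply/funext => x; case: (cc' x) => -[-> ->]; rewrite mule0 mule1 ?adde0 ?add0e.
have I0 : {ae prod_measure mu, forall v,
    int_set mu A (fun x => (kern_prod e A x)%:E * c' x) v = 0}.
  have := ae_eq_int_out (enum A) (mge0_marginal A) mgc Mgc.
  apply: filterS => v; rewrite -!/(int_set mu _ _ _) int_set_marginal => I1.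
  have := int_set_kern_prod_le1 v re ancA; rewrite gE /int_set int_outD//.
  rewrite -!/(int_set mu _ _ _) -I1.
  rewrite -[leRHS]adde0 leeD2lE// => I0; apply/eqP; rewrite eq_le I0 /=.
  exact: (mge0_int_set mu A mgc').2.
have := ae_int_set_eq0 mu A mgc'; move: I0; apply: filterS3 Mgc => v -> I0 /(_ I0).
by case: (cc' v) => -[-> ->]; rewrite mule1 ?mule0.
Qed.

(** The marginal densities of [A] and [A :|: S] differ by the factor
    [kern_prod e S], which does not depend on the nodes in [A :\: P]; integrating
    these out leaves the marginal densities of [P] and [S :|: P]. *)
Lemma marginal_block e A S P : ranked e -> factorizes e ->
  ancestral e A -> ancestral e (A :|: S) -> [disjoint A & S]%B ->
  (P \subset A)%SET ->
  (forall u, u \in S -> (pa e u \subset S :|: P)%SET) ->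
  {ae prod_measure mu, forall v,
    M (S :|: P)%SET v = (kern_prod e S v)%:E * M P v}.
Proof.
move=> re fe ancA ancAS dAS PA SP.
have mAS := marginal_ancestral re fe ancAS; have mA := marginal_ancestral re fe ancA.
have AS : {ae prod_measure mu, forall v,
    M (A :|: S)%SET v = (kern_prod e S v)%:E * M A v}.
  apply: filterS2 mAS mA => v -> ->; rewrite -EFinM mulrC; congr (_%:E).
  rewrite /kern_prod -bigU//=; apply: eq_bigl => u; by rewrite !inE.
have kS := mge0_kern_prod e S.
have := ae_eq_int_out (enum (A :\: P)%SET) (mge0_marginal _)
  (mge0M kS (mge0_marginal A)) AS.
apply: filterS => v.
have dS : depends_only (S :|: P)%SET (fun v => (kern_prod e S v)%:E).
  apply: depends_only_kern_prod => u uS.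
  rewrite finset.subUset finset.sub1set inE uS.
  exact: SP.
rewrite -!/(int_set mu _ _ _) (int_set_Z mu (mge0_marginal A) dS); last 2 first.
- rewrite -finset.setI_eq0; apply/eqP/finset.setP => u; rewrite !inE.
  case: (boolP (u \in A)) => uA; rewrite ?andbF//= (disjointFr dAS uA).
  by case: (u \in P).
- by move=> x; exact: kS.2.
have APE : A :\: P = (A :|: S) :\: (S :|: P) :> {set V}.
  apply/finset.setP => u; rewrite !inE negb_or.
  case: (boolP (u \in A)) => uA; rewrite ?(disjointFr dAS uA) ?andbT//=.
  by case: (u \in S); rewrite ?andbF.
rewrite {1}APE.
rewrite -marginal_int_set; last first.
  rewrite finset.subUset finset.subsetUr (fintype.subset_trans PA)//.
  exact: finset.subsetUl.
by rewrite -marginal_int_set.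
Qed.

(** If [S] comes after an ancestral set [A] and all parents of nodes of [S] are
    in [S] or in a subset [P] of [A], then the conditional density of [S] given
    [P] is the product of the kernels of [S]. *)
Lemma cond_block e A S P : ranked e -> factorizes e ->
  ancestral e A -> ancestral e (A :|: S) -> [disjoint A & S]%B ->
  (P \subset A)%SET ->
  (forall u, u \in S -> (pa e u \subset S :|: P)%SET) ->
  {ae prod_measure mu, forall v, cond_defined mu f P v ->
    cond mu f S P v = kern_prod e S v}.
Proof.
move=> re fe ancA ancAS dAS PA SP.
apply: filterS (marginal_block re fe ancA ancAS dAS PA SP) => v Mv /andP[M0 My].
rewrite /cond Mv fineM// ?mulfK//; first by rewrite gt_eqF// fine_gt0// M0.
by rewrite ge0_fin_numE// marginal_ge0.
Qed.

End Marginals.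

(** * Factorization over the buckets *)

Local Open Scope ring_scope.

Theorem corollary3p7 (R : realType) (V : finType) (d : V -> measure_display)
  (T : forall u : V, measurableType (d u))
  (mu : forall u : V, {sigma_finite_measure set (T u) -> \bar R})
  (G : graph V) (X : {set V}) (Vs : seq {set V}) :
  is_MPDAG G ->
  PCO_output [set: V]%SET G Vs ->
  forall f : vals T -> R, consistent mu f G ->
  {ae prod_measure mu, forall v : vals T,
    (forall S, S \in Vs -> cond_defined mu f (Pa S G) v) ->
    f v = \prod_(S <- Vs | S \subset [set: V]%SET) cond mu f S (Pa S G) v}
  /\
  forall D : graph V, represented D G ->
  (forall v x, v \notin X -> x \in X -> ~~ line G x v) ->
  {ae prod_measure mu, forall x : vals T,
   {ae prod_measure mu, forall v : vals T,
    (forall u, u \notin X ->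
       cond_defined mu f (Pa [set u]%SET D) (agree X x v)) ->
    (forall S, S \in Vs -> S \subset (~: X)%SET ->
       cond_defined mu f (Pa S G) (agree X x v)) ->
    do_density mu f D X x v =
      \prod_(S <- Vs | S \subset (~: X)%SET)
         cond mu f S (Pa S G) (agree X x v)}}.
Proof.
move=> _ pcoVs f [D0 D0G fD0]; have [fd _] := fD0.
(* Both claims follow by multiplying these identities over the buckets; [D] need
   not be the DAG that [f] is assumed consistent with. *)
have key D : represented D G -> {ae prod_measure mu, forall v : vals T,
    f v = \prod_u kern mu f (arrow D) u v /\
    forall S, S \in Vs -> cond_defined mu f (Pa S G) v ->
      cond mu f S (Pa S G) v = kern_prod mu f (arrow D) S v}.
  move=> DG; have rD := represented_ranked DG.
  have fD := factorizes_represented fd D0G DG (consistent_factorizes fd fD0).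
  suff blocks : {ae prod_measure mu, forall v : vals T,
      forall S, S \in Vs -> cond_defined mu f (Pa S G) v ->
      cond mu f S (Pa S G) v = kern_prod mu f (arrow D) S v}.
    by apply: filterS2 fD blocks => v ? ?; split.
  apply: filter_forall => S; have [SVs|nS] := boolP (S \in Vs); last exact: aeW.
  have [A [ancA ancAS dAS PA pS]] := PCO_output_block DG pcoVs SVs.
  have := cond_block fd rD fD ancA ancAS dAS PA pS; apply: filterS => v cb _.
  exact: cb.
split.
  apply: filterS (key D0 D0G) => v [-> blocks] defd.
  rewrite (big_PCO _ _ pcoVs) /= big_seq [RHS]big_seq_cond.
  apply: eq_big => [S|S SVs]; first by rewrite finset.subsetT andbT.
  by apply/esym/blocks => //; exact: defd.
move=> D DG nXl; apply: filterS (ae_agree X (key D DG)) => x.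
apply: filterS => v [fE blocks] _ defd.
(* For empty [X] the interventional density is [f] itself, not a product. *)
have -> : do_density mu f D X x v =
    \prod_(u | u \notin X) kern mu f (arrow D) u (agree X x v).
  rewrite /do_density; case: eqP => [X0|_]; last first.
    by apply: eq_bigr => u _; rewrite Pa1.
  have agreev : agree X x v = v.
    by apply: functional_extensionality_dep => u; rewrite /agree X0 inE.
  by rewrite agreev in fE *; rewrite fE; apply: eq_bigl => u; rewrite X0 inE.
rewrite (big_PCO_compl _ _ pcoVs nXl) /= big_seq_cond [RHS]big_seq_cond.
by apply: eq_bigr => S /andP[SVs SX]; apply/esym/blocks => //; exact: defd.
Qed.
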